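(* Suppose the numerical solutions $\widehat Y$ and $\widehat y$ both satisfy the Numerical Solution Assumption stated in the context. Then the variance of the new pathwise estimator with importance sampling $$\frac{\partial\breve F}{\partial\theta}=\left\langle\nabla\varphi(\widehat Y_T),\,\widehat y_T\right\rangle+\varphi(\widehat Y_T)\sum_{n=0}^{N-1}\frac{S}{\sigma}\left\langle\widehat y_{t_n},\,\Delta W_n\right\rangle$$ increases (at most) linearly with respect to $T$, that is, there is a constant $\eta''>0$, independent of $T$, such that for all $T>0$ $$\mathbb V\left[\frac{\partial\breve F}{\partial\theta}\right]\le\frac{\eta''}{\sigma^2}\,T .$$
   Context: Let $(\Omega,\mathcal F,\mathbb P)$ be a probability space with a normal filtration $(\mathcal F_t)_{t\ge 0}$ and an $m$-dimensional standard Brownian motion $W$. $\|\cdot\|$ is the Euclidean norm, $\langle\cdot,\cdot\rangle$ the inner product on $\mathbb R^m$, $I$ the $m\times m$ identity matrix, and $\mathbb V$ denotes variance under $\mathbb P$. SDE. Let $\sigma>0$ be a scalar, $\theta$ a real parameter, and $f(\theta;x)\in\mathbb R^m$ ($x\in\mathbb R^m$) a drift, locally Lipschitz in $x$ and differentiable in $(\theta,x)$, such that $\mathrm dX_t^{(\theta)}=f(\theta;X_t^{(\theta)})\,\mathrm dt+\sigma\,\mathrm dW_t$ with fixed initial value $\xi_0$ has a unique strong solution and is geometrically ergodic: $|\mathbb E[\varphi(X^{(\theta)}_T)]-\pi^{(\theta)}(\varphi)|\le\mu e^{-\lambda T}$ for some constants $\mu,\lambda>0$, where $\pi^{(\theta)}$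 is the invariant measure and $\pi^{(\theta)}(\varphi)$ the expectation of $\varphi$ under it. The function $\varphi:\mathbb R^m\to\mathbb R$ is differentiable, and $\varphi$ and $\nabla\varphi$ have polynomial growth. The sensitivity of $\mathbb E[\varphi(X_T^{(\theta)})]$ with respect to $\theta$ is considered at $\theta=0$, and $\partial\breve F/\partial\theta$ is a Monte Carlo estimator (a random variable) of it. Modified variation process. Let $S>0$ be a sufficiently large fixed constant (the spring coefficient). Let $Y$ and $y$ solve $$\mathrm dY_t=f(0;Y_t)\,\mathrm dt+\sigma\,\mathrm dW_t,\quad Y_0=\xi_0,$$ $$\mathrm dy_t=\left(\frac{\partial f}{\partial\theta}(0;Y_t)+\Big(\frac{\partial f}{\partial x}(0;Y_t)-S I\Big)y_t\right)\mathrm dt,\quad y_0=0 .$$ Numerical solutions. For each $T>0$, $\widehat Y=(\widehat Y_t)_{0\le t\le T}$ and $\widehat y=(\widehat y_t)_{0\le t\le T}$ are adapted numerical approximations of $Y$ and $y$ with $\widehat Y_0=\xi_0$, $\widehat y_0=0$, on a time grid $0=t_0<t_1<\dots<t_N=T$ with $t_{n+1}=t_n+h_n$ (uniform, or adaptive with $h_n$ determined by the information at time $t_n$), and $\Delta W_n=W_{t_{n+1}}-W_{t_n}$. The average timestep size is $h$. Numerical Solution Assumption. A numerical approximation $\widehat Z$ of a process $Z$ satisfies it if for every $p\ge1$ there are constants $C_p,c_p$ independent of $T$ such that for all $T>0$ $$\sup_{0\le t\le T}\mathbb E\big[\|\widehat Z_t\|^p\big]\le C_p,\qquad \sup_{0\le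 t\le T}\mathbb E\big[\|\widehat Z_t-Z_t\|^p\big]\le c_p\,h^p .$$ Here it is applied with $(\widehat Z,Z)=(\widehat Y,Y)$ and $(\widehat Z,Z)=(\widehat y,y)$.
   Formalization: The formal theorem also assumes that ∂f/∂θ(0;x) is locally bounded in x and, for adaptive (random) grids only, that ŷ at grid time t_n is known at time t_n and has bounded moments at the last grid time before t; without these the claim can fail. *)

(* Defs.v *)
From HB Require Import structures.
From mathcomp Require Import all_boot all_order all_algebra.
From mathcomp Require Import all_classical all_reals all_analysis.

Set Implicit Arguments.
Unset Strict Implicit.
Unset Printing Implicit Defensive.

Import Order.TTheory GRing.Theory Num.Theory.
Import numFieldNormedType.Exports.

Local Open Scope classical_set_scope.
Local Open Scope ring_scope.

(* The norm [`|x|] of MathComp-Analysis on ['rV[R]_m] is the sup norm; it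
   serves only for the topology and for differentiability.  All quantitative
   bounds use the Euclidean norm [enorm]. *)
Definition inner (R : realType) (m : nat) (x y : 'rV[R]_m) : R :=
  \sum_(i < m) x 0 i * y 0 i.

Definition enorm (R : realType) (m : nat) (x : 'rV[R]_m) : R :=
  Num.sqrt (inner x x).

Definition gradient (R : realType) (m : nat) (phi : 'rV[R]_m -> R)
    (x : 'rV[R]_m) : 'rV[R]_m :=
  \row_(i < m) 'D_(delta_mx 0 i) phi x.

Definition poly_growth (R : realType) (m : nat) (g : 'rV[R]_m -> R) : Prop :=
  exists (K : R) (q : nat), forall x, `|g x| <= K * (1 + enorm x ^+ q).

(* R^m as a measurable space (Borel sigma-algebra). *)
Definition borelV (R : realType) (m : nat) :=
  g_sigma_algebraType (@open 'rV[R]_m).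

(* A process is a map (time, outcome) |-> value; only times t >= 0 matter. *)

Section filtrations.
Context (R : realType) (d : measure_display) (Omega : measurableType d).
Variable P : probability Omega R.
Variable F : R -> set (set Omega).

(* The usual conditions; completeness is with respect to all P-negligible
   sets, measurable or not, so it also makes P complete. *)
Definition normal_filtration : Prop :=
  [/\ forall t, 0 <= t -> sigma_algebra setT (F t) /\ F t `<=` measurable,
      forall s t, 0 <= s -> s <= t -> F s `<=` F t,
      forall t, 0 <= t -> \bigcap_(s in [set s | t < s]) F s `<=` F t &
      forall A, P.-negligible A -> F 0 A].

Definition adapted_on (m : nat) (I : set R) (X : R -> Omega -> 'rV[R]_m) :
    Prop :=
  forall t (B : set (borelV R m)), I t -> measurable B -> F t (X t @^-1` B).

Definition stopped_sigma (tau : Omega -> R) : set (set Omega) :=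
  [set A | measurable A /\
           forall t, 0 <= t -> F t (A `&` [set w | tau w <= t])].

Definition continuous_paths (m : nat) (X : R -> Omega -> 'rV[R]_m) : Prop :=
  {ae P, forall w, {within `[0, +oo[, continuous (fun t => X t w)}}.

(* The last field says that the law of W_t - W_s is the product measure
   N(0, t - s) (x) ... (x) N(0, t - s), i.e. N(0, (t - s) I); the second
   argument of [normal_prob] is the standard deviation. *)
Definition brownian_motion (m : nat) (W : R -> Omega -> 'rV[R]_m) : Prop :=
  [/\ adapted_on `[0, +oo[ W,
      {ae P, forall w, W 0 w = 0},
      continuous_paths W,
      forall s t A (B : set (borelV R m)), 0 <= s -> s < t ->
        F s A -> measurable B ->
        let D := (fun w => W t w - W s w) @^-1` B in
        P (A `&` D) = (P A * P D)%E &
      forall s t (B : 'I_m -> set R), 0 <= s -> s < t ->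
        (forall i, measurable (B i)) ->
        P [set w | forall i, B i ((W t w - W s w) 0 i)] =
        (\prod_(i < m) normal_prob 0 (Num.sqrt (t - s)) (B i))%E].

End filtrations.

Section equations.
Context (R : realType) (m : nat) (d : measure_display)
  (Omega : measurableType d).
Variable P : probability Omega R.
Variable F : R -> set (set Omega).
Variable W : R -> Omega -> 'rV[R]_m.
Variable sigma : R.

(* Integral of g over [0, t], coordinate by coordinate. *)
Definition integralV (g : R -> 'rV[R]_m) (t : R) : 'rV[R]_m :=
  \row_(i < m) \int[lebesgue_measure]_(s in `[0, t]) g s 0 i.

Definition integrableV (g : R -> 'rV[R]_m) (t : R) : Prop :=
  forall i, lebesgue_measure.-integrable `[0, t] (fun s => (g s 0 i)%:E).

(* dX = b(X) dt + sigma dW, X_0 = x0.  The noise is additive, so the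
   stochastic integral is sigma W_t and the equation holds path by path. *)
Definition strong_solution (b : 'rV[R]_m -> 'rV[R]_m) (x0 : 'rV[R]_m)
    (X : R -> Omega -> 'rV[R]_m) : Prop :=
  [/\ adapted_on F `[0, +oo[ X, continuous_paths P X &
      {ae P, forall w, forall t, 0 <= t ->
        integrableV (fun s => b (X s w)) t /\
        X t w = x0 + integralV (fun s => b (X s w)) t + sigma *: W t w}].

Definition unique_strong_solution (b : 'rV[R]_m -> 'rV[R]_m)
    (x0 : 'rV[R]_m) (X : R -> Omega -> 'rV[R]_m) : Prop :=
  strong_solution b x0 X /\
  forall X', strong_solution b x0 X' ->
    {ae P, forall w, forall t, 0 <= t -> X' t w = X t w}.

(* pi is preserved by the transition probabilities p_t(x, B) = P(X^x_t in B),
   X^x being the solution started at x. *)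
Definition invariant_measure (b : 'rV[R]_m -> 'rV[R]_m)
    (pi : probability (borelV R m) R) : Prop :=
  exists X : 'rV[R]_m -> R -> Omega -> 'rV[R]_m,
    {ae pi, forall x, strong_solution b x (X x)} /\
    forall t (B : set (borelV R m)), 0 <= t -> measurable B ->
      (\int[pi]_x P (X x t @^-1` B))%E = pi B.

(* In [\bar R] the inequality forces both expectations to be finite, since
   [+oo - +oo = -oo]. *)
Definition geometrically_ergodic (b : 'rV[R]_m -> 'rV[R]_m)
    (phi : 'rV[R]_m -> R) (X : R -> Omega -> 'rV[R]_m) : Prop :=
  exists pi : probability (borelV R m) R,
    [/\ invariant_measure b pi,
        forall pi' : probability (borelV R m) R, invariant_measure b pi' ->
          forall B : set (borelV R m), measurable B -> pi' B = pi B &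
        exists mu lambda : R, [/\ 0 < mu, 0 < lambda &
          forall T, 0 < T ->
            (`| 'E_P[(fun w => phi (X T w))] - \int[pi]_x (phi x)%:E |
              <= (mu * expR (- (lambda * T)))%:E)%E]].

Variable f : R -> 'rV[R]_m -> 'rV[R]_m.

Definition dtheta (x : 'rV[R]_m) : 'rV[R]_m := derive1 (fun theta => f theta x) 0.

(* The local boundedness of [dtheta] holds as soon as f is continuously
   differentiable. *)
Definition regular_drift : Prop :=
  [/\ forall theta (x : 'rV[R]_m),
        exists2 U, nbhs x U & [lipschitz f theta z | z in U],
      forall z : R^o * 'rV[R]_m,
        differentiable (fun z : R^o * 'rV[R]_m => f z.1 z.2) z &
      forall x : 'rV[R]_m, exists K : R, \forall z \near x, enorm (dtheta z) <= K].

(* dy = (df/dtheta (0; Y) + (df/dx (0; Y) - S I) y) dt, y_0 = 0, where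
   [df/dx (0; x)] acts as the differential of [f 0] at x. *)
Definition modified_variation (S : R) (Y y : R -> Omega -> 'rV[R]_m) : Prop :=
  let drift w s :=
    dtheta (Y s w) + ('d (f 0) (Y s w) (y s w) - S *: y s w) in
  [/\ adapted_on F `[0, +oo[ y, continuous_paths P y &
      {ae P, forall w, forall t, 0 <= t ->
        integrableV (drift w) t /\ y t w = integralV (drift w) t}].

End equations.

Section grids.
Context (R : realType) (m : nat) (d : measure_display)
  (Omega : measurableType d).
Variable P : probability Omega R.
Variable F : R -> set (set Omega).

(* A grid 0 = t_0 < ... < t_N = T with random t_n and N, extended by t_n = T
   for n >= N.  Each t_(n+1), hence h_n, is known at time t_n.  Uniform grids
   are the case N constant and t_n = n T / N. *)
Definition time_grid (T : R) (N : Omega -> nat) (tg : nat -> Omega -> R) :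
    Prop :=
  [/\ {ae P, forall w,
        [/\ (0 < N w)%N, tg 0%N w = 0,
            forall n, (n < N w)%N -> tg n w < tg n.+1 w &
            forall n, (N w <= n)%N -> tg n w = T]},
      forall n (B : set R), measurable B ->
        stopped_sigma F (tg n) (tg n.+1 @^-1` B) &
      ('E_P[(fun w => (N w)%:R)] < +oo)%E].

Definition nonrandom_grid (tg : nat -> Omega -> R) : Prop :=
  exists s : nat -> R, forall n, {ae P, forall w, tg n w = s n}.

Definition average_step (T : R) (N : Omega -> nat) : R :=
  T / fine 'E_P[(fun w => (N w)%:R)]%E.

(* The last grid time that is <= t. *)
Definition last_grid_time (N : Omega -> nat) (tg : nat -> Omega -> R) (t : R)
    (w : Omega) : R :=
  \big[Num.max/0]_(n < (N w).+1 | tg n w <= t) tg n w.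

(* Adaptedness includes the random grid times: Z_(t_n) is known at time t_n,
   which on a nonrandom grid is just adaptedness at t_n. *)
Definition numerical_approximation (T : R) (tg : nat -> Omega -> R)
    (z0 : 'rV[R]_m) (Zh : R -> Omega -> 'rV[R]_m) : Prop :=
  [/\ {ae P, forall w, Zh 0 w = z0},
      adapted_on F `[0, T] Zh &
      forall n (B : set (borelV R m)), measurable B ->
        stopped_sigma F (tg n) ((fun w => Zh (tg n w) w) @^-1` B)].

Definition sup_moment (p T : R) (Z : R -> Omega -> 'rV[R]_m) : \bar R :=
  ereal_sup [set 'E_P[(fun w => (enorm (Z t w) `^ p)%R)]%E | t in `[0, T]].

(* [Zh T] is the numerical solution on [0, T] and [h T] its average step. *)
Definition numerical_solution_assumption (h : R -> R)
    (Zh : R -> R -> Omega -> 'rV[R]_m) (Z : R -> Omega -> 'rV[R]_m) : Prop :=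
  forall p : R, 1 <= p -> exists C c : R, forall T, 0 < T ->
    (sup_moment p T (Zh T) <= C%:E)%E /\
    (sup_moment p T (fun t w => (Zh T t w - Z t w)%R)
       <= (c * h T `^ p)%:E)%E.

(* On random grids the moment bound is read also at the last grid time before
   t: bounds at fixed times t alone say nothing about the values at random
   grid times.  On nonrandom grids it follows from the bound at fixed times. *)
Definition random_grid_moments (N : R -> Omega -> nat)
    (tg : R -> nat -> Omega -> R) (Zh : R -> R -> Omega -> 'rV[R]_m) : Prop :=
  forall p : R, 1 <= p -> exists C : R, forall T, 0 < T ->
    ~ nonrandom_grid (tg T) ->
    (sup_moment p T
       (fun t w => Zh T (last_grid_time (N T) (tg T) t w) w) <= C%:E)%E.

Definition pathwise_estimator (S sigma : R) (W : R -> Omega -> 'rV[R]_m)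
    (phi : 'rV[R]_m -> R) (T : R) (N : Omega -> nat) (tg : nat -> Omega -> R)
    (Yh yh : R -> Omega -> 'rV[R]_m) (w : Omega) : R :=
  inner (gradient phi (Yh T w)) (yh T w) +
  phi (Yh T w) *
    \sum_(n < N w) S / sigma *
      inner (yh (tg n w) w) (W (tg n.+1 w) w - W (tg n w) w).

End grids.

(* Main.v *)
Require Import Defs.
From HB Require Import structures.
From mathcomp Require Import all_boot all_order all_algebra.
From mathcomp Require Import all_classical all_reals all_analysis.
From mathcomp Require Import measurable_realfun.
From mathcomp Require Import ring lra.
Import Order.TTheory GRing.Theory Num.Theory.
Import numFieldNormedType.Exports.
Local Open Scope classical_set_scope.
Local Open Scope ring_scope.

(* On a fixed time grid a sum M of Gaussian increments with bounded
   predictable weights b satisfies E M^4 <= 2500 E V^2, where V is the sum of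
   b^2 times the step: by induction E M^4 <= E (48 M^2 V + 64 V^2), and
   M^2 V <= M^4 / 96 + 24 V^2.  The stochastic sum over the random grid is the
   almost sure limit of such sums, with weights sampled on finer and finer
   uniform grids, so by Fatou its fourth moment is at most a constant times
   T^2; with the moments of phi this bounds the second term of the estimator.
   The first term is bounded in L^2 uniformly in T, which is enough for T away
   from 0.  As T -> 0 its variance must itself be O(T): there the average step
   is at most T, and y_T = O(T) as long as the Brownian motion has not left a
   small ball, an event whose complement has probability O(T^2) by the same
   fourth moment bound applied to the stopped Brownian motion. *)

Set Implicit Arguments.
Unset Strict Implicit.
Unset Printing Implicit Defensive.

(** * Gaussian moments and independence *)

(** Fourth moments are needed, not second ones, because [phi (Yh T T w)] is correlated with the
    stochastic sum Z: Young's inequality phi^2 Z^2 <= T phi^4 + Z^4 / T separates the two, and E Z^4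
    = O(T^2) leaves O(T). The obstacle in bounding E Z^4 is that the times and the number of terms
    are random, so no fixed term of the sum is an increment over a deterministic interval. The value
    of [yh] at the last grid time before a fixed s is known at time s, however, hence is a
    legitimate weight on a deterministic uniform grid. Such weights are truncated at a level growing
    with the fineness of that grid: fourth moments are then finite beforehand, so that M^4 / 96 can
    be absorbed on the left, while the level itself does not enter the final bound. Integrals of
    nonnegative functions are taken in [0, +oo] and odd Gaussian terms are removed by
    symmetrization, so no signed integral occurs before the variance. The strong error of [yh]
    matters only as T tends to 0: with an average step at most T it gives E |yh_T - y_T|^p =
    O(T^p). *)

Section density.
Context d (T : measurableType d) (R : realType).
Variables (mu nu : {measure set T -> \bar R}) (g : T -> R).
Hypothesis g0 : forall x, 0 <= g x.
Hypothesis mg : measurable_fun setT g.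
Hypothesis nuE : forall A, measurable A -> nu A = (\int[mu]_(x in A) (g x)%:E)%E.

Import HBNNSimple.

(** Approximation by simple functions and monotone convergence on both sides reduce this to
    indicators, where it is [nuE]. *)
Lemma ge0_integral_density (f : T -> \bar R) : (forall x, 0 <= f x)%E ->
  measurable_fun setT f ->
  (\int[nu]_x f x = \int[mu]_x (f x * (g x)%:E))%E.
Proof.
move=> f0 mf; pose h := nnsfun_approx measurableT mf.
have mge : measurable_fun setT (EFin \o g) by exact/measurable_EFinP.
have -> : (\int[nu]_x f x =
    limn (fun n => \int[nu]_x (EFin \o h n) x))%E.
  have fE x : setT x -> f x = lim ((EFin \o h n) x @[n --> \oo]).
    by move=> Ex; apply/esym/cvg_lim => //; exact: cvg_nnsfun_approx.
  under eq_integral => x /[!inE] /fE -> //.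
  apply: monotone_convergence => //.
  - by move=> n; apply/measurable_EFinP.
  - by move=> n x _ //=; rewrite lee_fin.
  - by move=> x _ a b ab; rewrite lee_fin; exact/lefP/nd_nnsfun_approx.
have -> : (\int[mu]_x (f x * (g x)%:E) =
    limn (fun n => \int[mu]_x ((h n x)%:E * (g x)%:E)))%E.
  have fg x : setT x -> (f x * (g x)%:E)%E = lim ((h n x)%:E * (g x)%:E @[n --> \oo])%E.
    by move=> Ex; apply/esym/cvg_lim => //; apply: cvgeZr => //; exact: cvg_nnsfun_approx.
  under eq_integral => x /[!inE] /fg -> //.
  apply: monotone_convergence => [//| | |].
  - by move=> n; apply/emeasurable_funM => //; exact/measurable_EFinP.
  - by move=> n x _ /=; rewrite mule_ge0 ?lee_fin.
  - move=> x _ a b ab/=; rewrite lee_wpmul2r ?lee_fin//; exact/lefP/nd_nnsfun_approx.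
suff suf n : (\int[mu]_x ((h n x)%:E * (g x)%:E) = \int[nu]_x (EFin \o h n) x)%E.
  by congr (limn _); apply/funext => n; rewrite suf.
transitivity (\int[nu]_x
   (\sum_(y \in range (h n)) (y * \1_(h n @^-1` [set y]) x)%:E))%E; last first.
  by apply: eq_integral => t tE; rewrite /= fimfunE -fsumEFin.
have indich m r : measurable_fun setT (fun x => (r * \1_(h m @^-1` [set r]) x)%:E).
  by apply/measurable_EFinP; exact: measurable_funM.
rewrite ge0_integral_fsum//; last by move=> m y Ey; exact: nnfun_muleindic_ge0.
transitivity (\int[mu]_x (\sum_(y \in range (h n))
    (y * \1_(h n @^-1` [set y]) x)%:E * (g x)%:E))%E.
  under [RHS]eq_integral => x xE.
    rewrite -ge0_mule_fsuml => [|y]; last exact: nnfun_muleindic_ge0.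
    rewrite fsumEFin // -(fimfunE _ x); over.
  by [].
rewrite ge0_integral_fsum//; last 2 first.
  - by move=> y; apply: emeasurable_funM.
  - by move=> m y Ey; rewrite mule_ge0 ?lee_fin// -lee_fin nnfun_muleindic_ge0.
apply: eq_fsbigr => r rhn.
under [RHS]eq_integral do rewrite EFinM.
rewrite integralZl_indic_nnsfun => //.
under eq_integral do rewrite EFinM -muleA.
have r0 : 0 <= r by move: rhn; rewrite inE/= => -[x _ <-].
rewrite ge0_integralZl//.
- under eq_integral do rewrite muleC.
  rewrite (eq_integral ((EFin \o g) \_ (h n @^-1` [set r]))); last first.
    by move=> x xE; rewrite epatch_indic.
  by rewrite -integral_mkcondr setTI -nuE// integral_indic// setIT.
- by apply: emeasurable_funM => //; exact/measurable_EFinP.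
- by move=> x _; rewrite mule_ge0 ?lee_fin.
Qed.

End density.

Section gaussian.
Context (R : realType).
Variable s : R.
Hypothesis s0 : 0 < s.

Lemma ge0_integral_normal (f : R -> \bar R) : (forall x, 0 <= f x)%E ->
  measurable_fun setT f ->
  (\int[normal_prob 0 s]_x f x =
   \int[lebesgue_measure]_x (f x * (normal_pdf 0 s x)%:E))%E.
Proof.
move=> f0 mf; apply: ge0_integral_density => //.
  exact: normal_pdf_ge0.
exact: measurable_normal_pdf.
Qed.

Lemma ge0_integral_normalN (f : R -> \bar R) : (forall x, 0 <= f x)%E ->
  measurable_fun setT f ->
  (\int[normal_prob 0 s]_x f (- x)%R = \int[normal_prob 0 s]_x f x)%E.
Proof.
move=> f0 mf; rewrite !ge0_integral_normal//; last exact: measurableT_comp.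
pose h x := (f x * (normal_pdf 0 s x)%:E)%E.
have mh : measurable_fun setT h.
  apply: emeasurable_funM => //; apply/measurable_EFinP; exact: measurable_normal_pdf.
have h0 x : (0 <= h x)%E by rewrite mule_ge0// lee_fin normal_pdf_ge0.
rewrite -[RHS]/(\int[lebesgue_measure]_x h x)%E.
transitivity (\int[lebesgue_measure]_x h (- x)%R)%E.
  apply: eq_integral => x _; rewrite /h /normal_pdf gt_eqF//.
  by rewrite /normal_fun !subr0 sqrrN.
transitivity (\int[pushforward lebesgue_measure (-%R : _ -> measurableTypeR R)]_x h x)%E.
  by rewrite ge0_integral_pushforward//.
apply: eq_measure_integral => //= A mA _; exact: lebesgue_measureN.
Qed.

(* Domination: the [n]-th moment density of N(0, s^2) is at most [2 c s^n] times
   the density of N(0, 2 s^2), so no moment has to be computed. *)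
Lemma integral_normal_le (c : R) (n : nat) :
  0 <= c ->
  (forall u, `|u| ^+ n * expR (- u ^+ 2 / 2) <= c * expR (- u ^+ 2 / 4)) ->
  (\int[normal_prob 0 s]_x (`|x| ^+ n)%:E <= (2 * c * s ^+ n)%:E)%E.
Proof.
move=> c0 hc; rewrite ge0_integral_normal//; last first.
  apply/measurable_EFinP; apply: measurable_funX; exact: normr_measurable.
pose s2 := Num.sqrt 2 * s.
have r2 : 0 < Num.sqrt (2 : R) by rewrite sqrtr_gt0.
have s20 : 0 < s2 by rewrite mulr_gt0.
have -> : (2 * c * s ^+ n)%:E =
   (\int[lebesgue_measure]_x ((2 * c * s ^+ n)%:E * (normal_pdf 0 s2 x)%:E))%E.
  rewrite ge0_integralZl//; first by rewrite integral_normal_pdf mule1.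
  - by apply/measurable_EFinP; exact: measurable_normal_pdf.
  - by move=> x _; rewrite lee_fin normal_pdf_ge0.
  - by rewrite lee_fin !mulr_ge0// exprn_ge0// ltW.
apply: ge0_le_integral => //.
- by move=> x _; rewrite -EFinM lee_fin mulr_ge0// normal_pdf_ge0.
- apply: emeasurable_funM; apply/measurable_EFinP; last exact: measurable_normal_pdf.
  apply: measurable_funX; exact: normr_measurable.
- apply: emeasurable_funM; apply/measurable_EFinP => //; exact: measurable_normal_pdf.
move=> x _; rewrite -!EFinM lee_fin !normal_pdfE ?gt_eqF// /normal_fun !subr0.
have -> : normal_peak s2 = normal_peak s / Num.sqrt 2.
  rewrite /normal_peak -invfM; congr (_^-1).
  rewrite /s2 exprMn (_ : Num.sqrt 2 ^+ 2 = 2); last by rewrite sqr_sqrtr.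
  rewrite -sqrtrM; last by rewrite mulrn_wge0// mulr_ge0 ?pi_ge0// sqr_ge0.
  by congr (Num.sqrt _); rewrite mulr_natr -mulrA mulr_natl.
have p0 : 0 <= normal_peak s by exact: normal_peak_ge0.
have := hc (x / s).
rewrite normrM normfV (gtr0_norm s0) exprMn.
have -> : - (x / s) ^+ 2 / 2 = - x ^+ 2 / (s ^+ 2 *+ 2).
  rewrite -mulr_natr; field; exact: lt0r_neq0.
have -> : - (x / s) ^+ 2 / 4 = - x ^+ 2 / (s2 ^+ 2 *+ 2).
  have -> : s2 ^+ 2 *+ 2 = 4 * s ^+ 2.
    by rewrite /s2 exprMn sqr_sqrtr// -mulr_natr; ring.
  by field; exact: lt0r_neq0.
set E1 := expR _; set E2 := expR _ => H.
have sn0 : 0 <= s ^+ n by rewrite exprn_ge0// ltW.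
have snE : s ^+ n * s^-1 ^+ n = 1 by rewrite -exprMn divff ?expr1n// gt_eqF.
(* The peak of the wider density is smaller by a factor sqrt 2; the factor 2 in the bound makes up
   for it. *)
have sq2 : Num.sqrt 2 <= 2 :> R.
  by rewrite -[leRHS]ger0_norm// -sqrtr_sqr ler_sqrt; lra.
have r2i : 1 <= 2 * (Num.sqrt 2)^-1 :> R by rewrite ler_pdivlMr// mul1r.
have E20 : 0 <= E2 by exact: expR_ge0.
apply: (@le_trans _ _ (normal_peak s * (s ^+ n * (c * E2)))).
  rewrite mulrCA ler_wpM2l//.
  apply: (@le_trans _ _ (s ^+ n * (`|x| ^+ n * s^-1 ^+ n * E1))); last first.
    by rewrite ler_wpM2l.
  rewrite [leRHS](_ : _ = s ^+ n * s^-1 ^+ n * (`|x| ^+ n * E1)); last by ring.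
  by rewrite snE mul1r.
rewrite [leRHS](_ : _ = (normal_peak s * (s ^+ n * (c * E2))) * (2 * (Num.sqrt 2)^-1)); last by ring.
by rewrite ler_peMr// !mulr_ge0.
Qed.

(** Here c = 4, because v <= exp v at v = u^2 / 4. The exact moment is s^2; only finiteness of the
    constant matters. *)
Lemma integral_normal_sqr_le :
  (\int[normal_prob 0 s]_x (x ^+ 2)%:E <= (8 * s ^+ 2)%:E)%E.
Proof.
have -> : 8 * s ^+ 2 = 2 * 4 * s ^+ 2 by lra.
under eq_integral => x _ do rewrite -real_normK ?num_real//.
apply: integral_normal_le => // u.
have -> : - u ^+ 2 / 2 = - u ^+ 2 / 4 - u ^+ 2 / 4 by field.
rewrite expRD mulrA mulrAC ler_wpM2r ?expR_ge0//.
rewrite expRN ler_pdivrMr ?expR_gt0// real_normK ?num_real//.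
have := expR_ge1Dx (u ^+ 2 / 4); lra.
Qed.

(** Here c = 32, because v^2 / 2 <= exp v at v = u^2 / 4. The exact moment is 3 s^4. *)
Lemma integral_normal_exp4_le :
  (\int[normal_prob 0 s]_x (x ^+ 4)%:E <= (64 * s ^+ 4)%:E)%E.
Proof.
have -> : 64 * s ^+ 4 = 2 * 32 * s ^+ 4 by lra.
have sq4 (x : R) : x ^+ 4 = `|x| ^+ 4 by rewrite -normrX ger0_norm// exprn_even_ge0.
under eq_integral => x _ do rewrite sq4.
apply: integral_normal_le => // u.
have -> : - u ^+ 2 / 2 = - u ^+ 2 / 4 - u ^+ 2 / 4 by field.
rewrite expRD mulrA mulrAC ler_wpM2r ?expR_ge0//.
rewrite expRN ler_pdivrMr ?expR_gt0// -sq4.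
have u0 : 0 <= u ^+ 2 / 4 by rewrite divr_ge0// sqr_ge0.
have := expR_ge1Dxn 1 u0; rewrite (_ : 2`!%:R = 2 :> R)//.
have -> : (u ^+ 2 / 4) ^+ 2 = u ^+ 4 / 16 by field.
lra.
Qed.

End gaussian.

Section real_integrals.
Context d (T : measurableType d) (R : realType) (mu : {measure set T -> \bar R}).
Implicit Types f g : T -> R.

Lemma ge0_integral_EFinD f g : (forall x, 0 <= f x) -> (forall x, 0 <= g x) ->
  measurable_fun setT f -> measurable_fun setT g ->
  (\int[mu]_x (f x + g x)%:E = \int[mu]_x (f x)%:E + \int[mu]_x (g x)%:E)%E.
Proof.
move=> f0 g0 mf mg; under eq_integral do rewrite EFinD.
by apply: ge0_integralD => //; try exact/measurable_EFinP; move=> x _; rewrite lee_fin.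
Qed.

Lemma ge0_integral_EFinZl f (k : R) : 0 <= k -> (forall x, 0 <= f x) ->
  measurable_fun setT f ->
  (\int[mu]_x (k * f x)%:E = k%:E * \int[mu]_x (f x)%:E)%E.
Proof.
move=> k0 f0 mf; under eq_integral do rewrite EFinM.
by apply: ge0_integralZl => //; [exact/measurable_EFinP|move=> x _; rewrite lee_fin].
Qed.

Lemma ge0_le_integral_EFin f g : (forall x, 0 <= f x) ->
  measurable_fun setT f -> measurable_fun setT g -> (forall x, f x <= g x) ->
  (\int[mu]_x (f x)%:E <= \int[mu]_x (g x)%:E)%E.
Proof.
move=> f0 mf mg fg.
by apply: ge0_le_integral => //; try exact/measurable_EFinP; move=> x _; rewrite lee_fin.
Qed.

End real_integrals.

Section independence.
Context d (T : measurableType d) (R : realType) (P : probability T R).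
Context d1 (U : measurableType d1) d2 (V : measurableType d2).
Variables (gam : probability V R) (u : T -> U) (xi : T -> V).
Hypotheses (mu : measurable_fun setT u) (mxi : measurable_fun setT xi).
Hypothesis indep : forall (A : set U) (B : set V), measurable A -> measurable B ->
  P (u @^-1` A `&` xi @^-1` B) = (P (u @^-1` A) * gam B)%E.

(** The hypothesis [indep] says at once that [xi] has law [gam] and that it is independent of [u].
    It identifies the joint law with a product measure on rectangles, hence everywhere, and Tonelli
    gives the iterated integral. *)
Lemma ge0_integral_indep (f : U * V -> \bar R) :
  (forall z, 0 <= f z)%E -> measurable_fun setT f ->
  (\int[P]_w f (u w, xi w) = \int[P]_w \int[gam]_x f (u w, x))%E.
Proof.
move=> f0 mf.
pose u' : {mfun T >-> U} := mfun_Sub (mem_set mu).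
have mp : measurable_fun setT (fun w => (u w, xi w)) by exact: measurable_fun_pair.
pose p' : {mfun T >-> (U * V)%type} := mfun_Sub (mem_set mp).
transitivity (\int[distribution P p']_z f z)%E.
  by rewrite ge0_integral_distribution.
transitivity (\int[(distribution P u' \x gam)%E]_z f z)%E.
  apply: eq_measure_integral => //= A mA _; apply/esym.
  refine (product_measure_unique _ mA) => A1 B1 mA1 mB1.
  exact: indep mA1 mB1.
rewrite fubini_tonelli1// ge0_integral_distribution//.
  exact: measurable_fun_fubini_tonelli_F.
move=> y; apply: integral_ge0 => x _; exact: f0.
Qed.

End independence.

(* Symmetrization makes every odd power of a Gaussian vanish while keeping all
   integrands nonnegative, hence without integrability conditions. *)
Lemma integral_normal_symm_le (R : realType) (s : R) (f g : R -> R) : 0 < s ->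
  (forall x, 0 <= f x) -> measurable_fun setT f ->
  (forall x, 0 <= g x) -> measurable_fun setT g ->
  (forall x, f x + f (- x) <= g x + g (- x)) ->
  (\int[normal_prob 0 s]_x (f x)%:E <= \int[normal_prob 0 s]_x (g x)%:E)%E.
Proof.
move=> s0 f0 mf g0 mg fg.
have E (h : R -> R) : (forall x, 0 <= h x) -> measurable_fun setT h ->
    (2%:E * \int[normal_prob 0 s]_x (h x)%:E = \int[normal_prob 0 s]_x (h x + h (- x))%:E)%E.
  move=> h0 mh.
  have mhN : measurable_fun setT (fun x : R => h (- x)) by exact: measurableT_comp.
  under [RHS]eq_integral do rewrite EFinD.
  rewrite ge0_integralD//; last 4 first.
  - by move=> x _; rewrite lee_fin.
  - exact/measurable_EFinP.
  - by move=> x _; rewrite lee_fin.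
  - exact/measurable_EFinP.
  have -> : (\int[normal_prob 0 s]_x (h (- x))%:E = \int[normal_prob 0 s]_x (h x)%:E)%E.
    apply: (@ge0_integral_normalN _ _ s0 (EFin \o h)); last exact/measurable_EFinP.
    by move=> x; rewrite lee_fin.
  by rewrite mule_natl mule2n.
rewrite -(@lee_pmul2l _ 2%:E)// !E//.
have mN (h : R -> R) : measurable_fun setT h ->
    measurable_fun setT (fun x : R => (h x + h (- x))%:E).
  move=> mh; apply/measurable_EFinP/measurable_funD => //; exact: measurableT_comp.
apply: ge0_le_integral => //; try exact: mN.
- by move=> x _; rewrite lee_fin addr_ge0.
- by move=> x _; rewrite lee_fin.
Qed.

Lemma probability_integral_cst d (T : measurableType d) (R : realType)
  (P : probability T R) (r : R) : (\int[P]_x r%:E)%E = r%:E.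
Proof.
transitivity (r%:E * P setT)%E; first exact: integral_cst.
by rewrite probability_setT mule1.
Qed.

Lemma integral_normal_poly_le (R : realType) (s a b c : R) : 0 < s ->
  0 <= a -> 0 <= b -> 0 <= c ->
  (\int[normal_prob 0 s]_x (a + b * x ^+ 2 + c * x ^+ 4)%:E <=
   (a + b * (8 * s ^+ 2) + c * (64 * s ^+ 4))%:E)%E.
Proof.
move=> s0 a0 b0 c0.
have mX n : measurable_fun setT (fun x : R => x ^+ n) by exact: measurable_funX.
have X2 (x : R) : 0 <= x ^+ 2 by exact: exprn_even_ge0.
have X4 (x : R) : 0 <= x ^+ 4 by exact: exprn_even_ge0.
have mZ e n : measurable_fun setT (fun x : R => e * x ^+ n) by exact: measurable_funM.
have bX (x : R) : 0 <= b * x ^+ 2 by rewrite mulr_ge0.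
have cX (x : R) : 0 <= c * x ^+ 4 by rewrite mulr_ge0.
have aX (x : R) : 0 <= a + b * x ^+ 2 by rewrite addr_ge0.
have maX : measurable_fun setT (fun x : R => a + b * x ^+ 2) by exact: measurable_funD.
rewrite (ge0_integral_EFinD (normal_prob 0 s) aX cX maX (mZ c 4%N)).
rewrite (ge0_integral_EFinD (normal_prob 0 s) (fun=> a0) bX (measurable_cst a) (mZ b 2%N)).
rewrite (probability_integral_cst (normal_prob 0 s)).
rewrite (ge0_integral_EFinZl (normal_prob 0 s) b0 X2 (mX 2%N)).
rewrite (ge0_integral_EFinZl (normal_prob 0 s) c0 X4 (mX 4%N)).
rewrite !EFinD (EFinM b) (EFinM c); apply: leeD; first apply: leeD => //.
- apply: lee_wpmul2l => //; exact: integral_normal_sqr_le.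
- apply: lee_wpmul2l => //; exact: integral_normal_exp4_le.
Qed.

(** * One step M + b xi of a discrete martingale, with xi Gaussian and independent of (M, b, V) *)

Section gaussian_step.
Context d (T : measurableType d) (R : realType) (P : probability T R).
Variables (M b V xi : T -> R) (s : R).
Hypotheses (s0 : 0 < s) (mM : measurable_fun setT M) (mb : measurable_fun setT b)
  (mV : measurable_fun setT V) (mxi : measurable_fun setT xi).
Hypothesis V0 : forall w, 0 <= V w.
Hypothesis indep : forall (A : set (R * R * R)) (B : set R),
  measurable A -> measurable B ->
  P ((fun w => (M w, b w, V w)) @^-1` A `&` xi @^-1` B) =
  (P ((fun w => (M w, b w, V w)) @^-1` A) * normal_prob 0 s B)%E.

Let u w := (M w, b w, V w).
Let mu : measurable_fun setT u.
Proof. by do 2 (apply: measurable_fun_pair => //). Qed.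

Lemma gaussian_step_integral (f : R * R * R -> R -> R) :
  (forall z x, 0 <= f z x) -> measurable_fun setT (fun z => f z.1 z.2) ->
  (\int[P]_w (f (u w) (xi w))%:E = \int[P]_w \int[normal_prob 0 s]_x (f (u w) x)%:E)%E.
Proof.
move=> f0 mf.
apply: (@ge0_integral_indep _ _ _ P _ _ _ _ (normal_prob 0 s) u xi mu mxi indep
   (fun z => (f z.1 z.2)%:E)) => //.
  by move=> z; rewrite lee_fin.
exact/measurable_EFinP.
Qed.

Lemma measurable_step_integral (f : R * R * R -> R -> R) :
  (forall z x, 0 <= f z x) -> measurable_fun setT (fun z => f z.1 z.2) ->
  measurable_fun setT (fun w => \int[normal_prob 0 s]_x (f (u w) x)%:E)%E.
Proof.
move=> f0 mf.
have h : measurable_fun setT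
    (fun z : R * R * R => \int[normal_prob 0 s]_x (f z x)%:E)%E.
  apply: (@measurable_fun_fubini_tonelli_F _ _ _ _ _ (normal_prob 0 s)
    (fun z : (R * R * R) * R => (f z.1 z.2)%:E)).
    exact/measurable_EFinP.
  by move=> z; rewrite lee_fin.
exact: measurableT_comp h mu.
Qed.

(** With (M, b) frozen, the terms of (M + b x)^4 odd in x cancel by symmetrization; 48 = 6 * 8 and
    64 come from the Gaussian moment bounds for the x^2 and x^4 terms. *)
Lemma gaussian_step_exp4 :
  (\int[P]_w ((M w + b w * xi w) ^+ 4)%:E <=
   \int[P]_w (M w ^+ 4 + 48 * s ^+ 2 * (M w ^+ 2 * b w ^+ 2) + 64 * s ^+ 4 * b w ^+ 4)%:E)%E.
Proof.
pose f (z : R * R * R) x := (z.1.1 + z.1.2 * x) ^+ 4.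
have f0 z x : 0 <= f z x by rewrite exprn_even_ge0.
have mf : measurable_fun setT (fun z => f z.1 z.2).
  apply: measurable_funX; apply: measurable_funD.
    by do 2 (apply: measurableT_comp => //).
  apply: measurable_funM => //; by do 2 (apply: measurableT_comp => //).
rewrite (gaussian_step_integral f0 mf).
apply: ge0_le_integral => //=.
- by move=> w _; apply: integral_ge0 => x _; rewrite lee_fin.
- exact: measurable_step_integral.
- by apply/measurable_EFinP; do !apply: measurable_funD; do ?apply: measurable_funM => //;
    do ?apply: measurable_funM => //; exact: measurable_funX.
move=> w _.
have mg (c e : R) n : measurable_fun setT (fun x : R => c + e * x ^+ n).
  apply: measurable_funD => //; apply: measurable_funM => //; exact: measurable_funX.
apply: (@le_trans _ _ (\int[normal_prob 0 s]_x (M w ^+ 4 +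
   6 * (M w ^+ 2 * b w ^+ 2) * x ^+ 2 + b w ^+ 4 * x ^+ 4)%:E)%E).
  apply: integral_normal_symm_le => //.
  - rewrite /f/=; apply: measurable_funX; exact: (mg _ _ 1%N).
  - by move=> x; do ![exact: exprn_even_ge0|apply: addr_ge0|apply: mulr_ge0|done].
  - apply: measurable_funD => //; apply: measurable_funM => //; exact: measurable_funX.
  - move=> x; rewrite le_eqVlt; apply/orP; left; apply/eqP; rewrite /f /u/=; ring.
have M4 : 0 <= M w ^+ 4 by exact: exprn_even_ge0.
have b4 : 0 <= b w ^+ 4 by exact: exprn_even_ge0.
have Mb : 0 <= 6 * (M w ^+ 2 * b w ^+ 2).
  by do ![exact: exprn_even_ge0|apply: mulr_ge0|done].
apply: (le_trans (integral_normal_poly_le s0 M4 Mb b4)).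
by rewrite lee_fin; lra.
Qed.

(** Submartingale property of M^2 with a weight V already known before the step: the cross term 2 M
    b x cancels by symmetrization and (b x)^2 V is nonnegative. *)
Lemma gaussian_step_sqr :
  (\int[P]_w (M w ^+ 2 * V w)%:E <=
   \int[P]_w ((M w + b w * xi w) ^+ 2 * V w)%:E)%E.
Proof.
(* The maximum makes [f] nonnegative on all triples; on the values actually taken it equals V. *)
pose f (z : R * R * R) x := (z.1.1 + z.1.2 * x) ^+ 2 * Num.max 0 z.2.
have f0 z x : 0 <= f z x by rewrite mulr_ge0 ?exprn_even_ge0// le_max lexx.
have mf : measurable_fun setT (fun z => f z.1 z.2).
  apply: measurable_funM.
    apply: measurable_funX; apply: measurable_funD.
      by do 2 (apply: measurableT_comp => //).
    apply: measurable_funM => //; by do 2 (apply: measurableT_comp => //).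
  by apply: measurable_maxr => //; apply: measurableT_comp => //.
have maxV w : Num.max 0 (V w) = V w by apply/max_idPr; exact: V0.
under [leRHS]eq_integral => w _.
  rewrite (_ : (M w + b w * xi w) ^+ 2 * V w = f (u w) (xi w)); last by rewrite /f/= maxV.
  over.
rewrite (gaussian_step_integral f0 mf).
apply: ge0_le_integral => //=.
- by move=> w _; rewrite lee_fin mulr_ge0// exprn_even_ge0.
- by apply/measurable_EFinP/measurable_funM => //; exact: measurable_funX.
- exact: measurable_step_integral.
move=> w _; rewrite /f/= maxV.
apply: (@le_trans _ _ (\int[normal_prob 0 s]_x (M w ^+ 2 * V w)%:E)%E).
  by rewrite (probability_integral_cst (normal_prob 0 s)).
apply: integral_normal_symm_le => //.
- by move=> x; rewrite mulr_ge0// exprn_even_ge0.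
- by move=> x; rewrite mulr_ge0// exprn_even_ge0.
- have ml : measurable_fun setT (fun x : R => M w + b w * x).
    by apply: measurable_funD => //; exact: measurable_funM.
  apply: measurable_funM => //; exact: measurable_funX ml.
move=> x; rewrite -!mulrDl ler_wpM2r//.
rewrite -subr_ge0 [leRHS](_ : _ = (b w * x) ^+ 2 *+ 2); last by ring.
by rewrite mulrn_wge0// sqr_ge0.
Qed.

End gaussian_step.

(** * Fourth moments of discrete stochastic sums *)

Lemma sqr_sum_le (R : realFieldType) n (x : 'I_n -> R) :
  (\sum_(i < n) x i) ^+ 2 <= n%:R * \sum_(i < n) x i ^+ 2.
Proof.
rewrite expr2 mulr_suml.
have -> : n%:R * \sum_(i < n) x i ^+ 2 =
    \sum_(i < n) \sum_(j < n) (x i ^+ 2 + x j ^+ 2) / 2.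
  under [RHS]eq_bigr => i _ do rewrite -mulr_suml big_split/= sumr_const card_ord.
  by rewrite -mulr_suml big_split/= sumrMnl sumr_const card_ord -[(\sum_(i < n) x i ^+ 2) *+ n]mulr_natl; field.
apply: ler_sum => i _; rewrite mulr_sumr; apply: ler_sum => j _.
have := sqr_ge0 (x i - x j); nra.
Qed.

Lemma exp4_sum_le (R : realFieldType) n (x : 'I_n -> R) :
  (\sum_(i < n) x i) ^+ 4 <= n%:R ^+ 3 * \sum_(i < n) x i ^+ 4.
Proof.
have -> : (\sum_(i < n) x i) ^+ 4 = ((\sum_(i < n) x i) ^+ 2) ^+ 2 by rewrite -exprM.
have h := sqr_sum_le x.
apply: (@le_trans _ _ ((n%:R * \sum_(i < n) x i ^+ 2) ^+ 2)).
  by rewrite ler_sqr ?nnegrE ?sqr_ge0// (le_trans _ h)// sqr_ge0.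
rewrite exprMn (exprSr _ 2) -mulrA ler_wpM2l ?exprn_even_ge0//.
apply: (le_trans (sqr_sum_le _)).
by under eq_bigr do rewrite -exprM.
Qed.

Section sub_measurability.
Context d (T : measurableType d) (R : realType).
Variable G : set (set T).

Definition sub_measurable_fun d' (U : measurableType d') (g : T -> U) :=
  forall B, measurable B -> G (g @^-1` B).

Hypothesis sG : sigma_algebra setT G.

(** Gives access to the closure properties of [measurable_fun] for measurability with respect to G:
    a sigma-algebra generates itself. *)
Lemma sub_measurable_funP d' (U : measurableType d') (g : T -> U) :
  sub_measurable_fun g <-> measurable_fun setT (g : g_sigma_algebraType G -> U).
Proof.
split=> [h _ B mB|h B mB].
  by rewrite setTI; apply: sub_sigma_algebra; exact: h.
have := h measurableT B mB; rewrite setTI.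
by rewrite /measurable/= sigma_algebra_id.
Qed.

End sub_measurability.

Section discrete_martingale.
Context d (T : measurableType d) (R : realType) (P : probability T R).
Variables (F : R -> set (set T)) (w : R -> T -> R).
Hypothesis FP : forall t : R, 0 <= t -> sigma_algebra setT (F t) /\ F t `<=` measurable.
Hypothesis Fmono : forall s t : R, 0 <= s -> s <= t -> F s `<=` F t.
Hypothesis wF : forall t : R, 0 <= t -> sub_measurable_fun (F t) (w t).
Hypothesis winc : forall (s t : R) (A : set T) (B : set R), 0 <= s -> s < t -> F s A ->
  measurable B ->
  P (A `&` (fun x => w t x - w s x) @^-1` B) =
  (P A * normal_prob 0 (Num.sqrt (t - s)) B)%E.

Lemma sub_measurable_le d' (U : measurableType d') s t (g : T -> U) :
  0 <= s -> s <= t -> sub_measurable_fun (F s) g -> sub_measurable_fun (F t) g.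
Proof. by move=> s0 st h B mB; apply: (Fmono s0 st); exact: h. Qed.

Lemma sub_measurable_measurable d' (U : measurableType d') s (g : T -> U) :
  0 <= s -> sub_measurable_fun (F s) g -> measurable_fun setT g.
Proof.
by move=> s0 h _ B mB; rewrite setTI; apply: (FP s0).2; exact: h.
Qed.

Section fixed_grid.
Variables (s : nat -> R) (b : nat -> T -> R) (K : R).
Hypotheses (s0 : 0 <= s 0%N) (sS : forall p, s p < s p.+1).
Hypothesis bF : forall p, sub_measurable_fun (F (s p)) (b p).
Hypothesis bK : forall p x, `|b p x| <= K.

Let M p x := \sum_(q < p) b q x * (w (s q.+1) x - w (s q) x).
Let V p x := \sum_(q < p) (s q.+1 - s q) * b q x ^+ 2.

Let sge0 p : 0 <= s p.
Proof. by elim: p => // p ih; exact: le_trans (ltW (sS p)). Qed.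

Let dF p g : sub_measurable_fun (F (s p)) g <->
   measurable_fun setT (g : g_sigma_algebraType (F (s p)) -> R).
Proof. by apply: sub_measurable_funP; exact: (FP (sge0 p)).1. Qed.

Let MF p : sub_measurable_fun (F (s p)) (M p).
Proof.
elim: p => [|p ih].
  by apply/dF; rewrite /M; under eq_fun do rewrite big_ord0; exact: measurable_cst.
apply/dF; rewrite /M; under eq_fun do rewrite big_ord_recr/=.
have up g : sub_measurable_fun (F (s p)) g -> measurable_fun setT (g : g_sigma_algebraType (F (s p.+1)) -> R).
  by move=> h; apply/dF; apply: sub_measurable_le h => //; exact: ltW.
apply: measurable_funD; first exact: up.
apply: measurable_funM; first exact: up.
apply: measurable_funB; last by apply: up; exact: wF.
by apply/dF; exact: wF.
Qed.

(** The shift matters: V is predictable, so [V p.+1] is known at time [s p] and can weight the step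
    from p to p + 1. *)
Let VF p : sub_measurable_fun (F (s p)) (V p.+1).
Proof.
elim: p => [|p ih].
  apply/dF; rewrite /V; under eq_fun do rewrite big_ord_recr big_ord0/= add0r.
  by apply: measurable_funM => //; apply: measurable_funX; exact/dF.
apply/dF; rewrite /V; under eq_fun do rewrite big_ord_recr/=.
apply: measurable_funD.
  by apply/dF; apply: sub_measurable_le ih => //; exact: ltW.
by apply: measurable_funM => //; apply: measurable_funX; exact/dF.
Qed.

Let V0 p x : 0 <= V p x.
Proof. by apply: sumr_ge0 => q _; rewrite mulr_ge0 ?sqr_ge0// subr_ge0 ltW. Qed.

Let mM p : measurable_fun setT (M p).
Proof. exact: sub_measurable_measurable (MF p). Qed.

Let mb p : measurable_fun setT (b p).
Proof. exact: sub_measurable_measurable (bF p). Qed.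

Let mV p : measurable_fun setT (V p).
Proof.
case: p => [|p]; last exact: sub_measurable_measurable (VF p).
by rewrite /V; under eq_fun do rewrite big_ord0; exact: measurable_cst.
Qed.

Let mw p : measurable_fun setT (w (s p)).
Proof. by apply: sub_measurable_measurable (wF _). Qed.

Let xi p x := w (s p.+1) x - w (s p) x.
Let mxi p : measurable_fun setT (xi p).
Proof. by apply: measurable_funB. Qed.

Let h p := s p.+1 - s p.
Let h0 p : 0 < h p. Proof. by rewrite subr_gt0. Qed.
Let sh0 p : 0 < Num.sqrt (h p). Proof. by rewrite sqrtr_gt0. Qed.

Let indep p (A : set (R * R * R)) (B : set R) :
  measurable A -> measurable B ->
  P ((fun x => (M p x, b p x, V p.+1 x)) @^-1` A `&` xi p @^-1` B) =
  (P ((fun x => (M p x, b p x, V p.+1 x)) @^-1` A) * normal_prob 0 (Num.sqrt (h p)) B)%E.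
Proof.
move=> mA mB; apply: winc => //.
suff : sub_measurable_fun (F (s p)) (fun x => (M p x, b p x, V p.+1 x)) by exact.
apply/(sub_measurable_funP (FP (sge0 p)).1).
apply: measurable_fun_pair; last exact/dF.
by apply: measurable_fun_pair; exact/dF.
Qed.

Let ME p x : M p.+1 x = M p x + b p x * xi p x.
Proof. by rewrite /M big_ord_recr. Qed.

Let VE p x : V p.+1 x = V p x + h p * b p x ^+ 2.
Proof. by rewrite /V big_ord_recr. Qed.

Let step4 p :
  (\int[P]_x (M p.+1 x ^+ 4)%:E <=
   \int[P]_x (M p x ^+ 4 + (48 * h p * (M p x ^+ 2 * b p x ^+ 2) + 64 * h p ^+ 2 * b p x ^+ 4))%:E)%E.
Proof.
under eq_integral do rewrite ME.
apply: (le_trans (gaussian_step_exp4 (sh0 p) (mM p) (mb p) (mV p.+1) (mxi p) (@indep p))).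
rewrite le_eqVlt; apply/orP; left; apply/eqP; apply: eq_integral => x _.
have -> : Num.sqrt (h p) ^+ 4 = (Num.sqrt (h p) ^+ 2) ^+ 2 by rewrite -exprM.
by rewrite sqr_sqrtr ?ltW// addrA.
Qed.

Let step2 p : (\int[P]_x (M p x ^+ 2 * V p.+1 x)%:E <=
   \int[P]_x (M p.+1 x ^+ 2 * V p.+1 x)%:E)%E.
Proof.
under [leRHS]eq_integral do rewrite ME.
exact: (gaussian_step_sqr (sh0 p) (mM p) (mb p) (mV p.+1) (mxi p) (@V0 p.+1) (@indep p)).
Qed.

(** Finiteness is what later allows half of E M^4 to be subtracted from both sides; the bound [K] on
    the weights enters here. From 48 h M^2 b^2 <= 24 M^4 + 24 h^2 b^4 one gets 25 = 1 + 24 and 88 =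
    64 + 24. *)
Let Mfin p : (\int[P]_x (M p x ^+ 4)%:E < +oo)%E.
Proof.
elim: p => [|p ih].
  rewrite /M; under eq_integral do rewrite big_ord0 expr0n/=.
  by rewrite integral0.
apply: (le_lt_trans (step4 p)).
apply: (@le_lt_trans _ _ (\int[P]_x (25 * M p x ^+ 4 + 88 * h p ^+ 2 * K ^+ 4)%:E)%E).
  apply: ge0_le_integral_EFin.
  - by move=> x; do ![exact: exprn_even_ge0|done|exact: ltW|apply: addr_ge0|apply: mulr_ge0].
  - do ![exact: measurable_funX|exact: measurable_cst|apply: measurable_funD|apply: measurable_funM].
  - do ![exact: measurable_funX|exact: measurable_cst|apply: measurable_funD|apply: measurable_funM].
  move=> x.
  have b4 : b p x ^+ 4 <= K ^+ 4.
    rewrite -[leLHS]ger0_norm ?exprn_even_ge0// normrX lerXn2r ?nnegrE//.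
    exact: le_trans (bK p x).
  have hb : h p ^+ 2 * b p x ^+ 4 <= h p ^+ 2 * K ^+ 4 by rewrite ler_wpM2l ?sqr_ge0.
  have := sqr_ge0 (M p x ^+ 2 - h p * b p x ^+ 2).
  have -> : (M p x ^+ 2 - h p * b p x ^+ 2) ^+ 2 = M p x ^+ 4 -
     2 * (h p * (M p x ^+ 2 * b p x ^+ 2)) + h p ^+ 2 * b p x ^+ 4 by ring.
  by move: hb; rewrite -!mulrA; lra.
rewrite (ge0_integral_EFinD P (f := fun x => 25 * M p x ^+ 4) (g := cst (88 * h p ^+ 2 * K ^+ 4))).
- rewrite (ge0_integral_EFinZl P (f := fun x => M p x ^+ 4))//.
  + rewrite probability_integral_cst lte_add_pinfty ?ltry//.
    by rewrite lte_mul_pinfty.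
  + by move=> x; exact: exprn_even_ge0.
  + exact: measurable_funX.
- by move=> x; rewrite mulr_ge0// exprn_even_ge0.
- by move=> x /=; do ![exact: exprn_even_ge0|done|apply: mulr_ge0].
- by apply: measurable_funM => //; exact: measurable_funX.
- exact: measurable_cst.
Qed.

Let bound p : (\int[P]_x (M p x ^+ 4)%:E <=
  \int[P]_x (48 * (M p x ^+ 2 * V p x) + 64 * V p x ^+ 2)%:E)%E.
Proof.
have mMV q r : measurable_fun setT (fun x => M q x ^+ 2 * V r x).
  by apply: measurable_funM => //; exact: measurable_funX.
have MV0 q r x : 0 <= M q x ^+ 2 * V r x by rewrite mulr_ge0// sqr_ge0.
have mV2 q : measurable_fun setT (fun x => V q x ^+ 2) by exact: measurable_funX.
have c48 q r x : 0 <= 48 * (M q x ^+ 2 * V r x) by rewrite mulr_ge0.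
have c64 q x : 0 <= 64 * V q x ^+ 2 by rewrite mulr_ge0// sqr_ge0.
have mc (c : R) (g : T -> R) : measurable_fun setT g -> measurable_fun setT (fun x => c * g x).
  by move=> ?; exact: measurable_funM.
elim: p => [|p ih].
  rewrite /M; under eq_integral do rewrite big_ord0 expr0n/=.
  rewrite integral0; apply: integral_ge0 => x _.
  rewrite lee_fin; apply: addr_ge0; apply: mulr_ge0 => //; [exact: (MV0 0%N 0%N x)|exact: sqr_ge0].
apply: (le_trans (step4 p)).
have e0 x : 0 <= 48 * h p * (M p x ^+ 2 * b p x ^+ 2) + 64 * h p ^+ 2 * b p x ^+ 4.
  by do ![exact: exprn_even_ge0|done|exact: ltW|apply: addr_ge0|apply: mulr_ge0].
have me : measurable_fun setT (fun x => 48 * h p * (M p x ^+ 2 * b p x ^+ 2) + 64 * h p ^+ 2 * b p x ^+ 4).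
  do ![exact: measurable_funX|exact: measurable_cst|apply: measurable_funD|apply: measurable_funM].
rewrite (ge0_integral_EFinD P (f := fun x => M p x ^+ 4)) => //; last 2 first.
- by move=> x; exact: exprn_even_ge0.
- exact: measurable_funX.
apply: le_trans (leeD ih (lexx _)) _.
rewrite -ge0_integral_EFinD => //; last 2 first.
- by move=> x; rewrite addr_ge0.
- by apply: measurable_funD; exact: mc.
(* With M frozen, replacing [V p] by [V p.+1] absorbs exactly the terms created by [step4]; [step2]
   then advances M. *)
apply: (@le_trans _ _ (\int[P]_x (48 * (M p x ^+ 2 * V p.+1 x) + 64 * V p.+1 x ^+ 2)%:E)%E).
  apply: ge0_le_integral_EFin.
  - by move=> x; rewrite addr_ge0// addr_ge0.
  - by apply: measurable_funD => //; apply: measurable_funD; exact: mc.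
  - by apply: measurable_funD; exact: mc.
  move=> x; rewrite VE.
  have : 0 <= V p x * (h p * b p x ^+ 2) by rewrite mulr_ge0// mulr_ge0 ?sqr_ge0// ltW.
  have -> : (V p x + h p * b p x ^+ 2) ^+ 2 = V p x ^+ 2 + 2 * (V p x * (h p * b p x ^+ 2)) + h p ^+ 2 * b p x ^+ 4 by ring.
  have -> : M p x ^+ 2 * (V p x + h p * b p x ^+ 2) = M p x ^+ 2 * V p x + h p * (M p x ^+ 2 * b p x ^+ 2) by ring.
  rewrite -!mulrA; lra.
rewrite !(ge0_integral_EFinD P (g := fun x => 64 * V p.+1 x ^+ 2)) //; try exact: mc.
apply: leeD => //.
rewrite (ge0_integral_EFinZl P (f := fun x => M p x ^+ 2 * V p.+1 x))//.
rewrite (ge0_integral_EFinZl P (f := fun x => M p.+1 x ^+ 2 * V p.+1 x))//.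
exact: lee_wpmul2l (step2 p).
Qed.

Lemma martingale_exp4_le p : (\int[P]_x ((\sum_(q < p) b q x * (w (s q.+1) x - w (s q) x)) ^+ 4)%:E <=
  (50 * 50)%:E * \int[P]_x ((\sum_(q < p) (s q.+1 - s q) * b q x ^+ 2) ^+ 2)%:E)%E.
Proof.
rewrite -[leLHS]/(\int[P]_x (M p x ^+ 4)%:E)%E -[X in (_ <= _ * X)%E]/(\int[P]_x (V p x ^+ 2)%:E)%E.
have m4 : measurable_fun setT (fun x => M p x ^+ 4) by exact: measurable_funX.
have mV2 : measurable_fun setT (fun x => V p x ^+ 2) by exact: measurable_funX.
have M40 x : 0 <= M p x ^+ 4 by exact: exprn_even_ge0.
have V20 x : 0 <= V p x ^+ 2 by exact: sqr_ge0.
have : (\int[P]_x (M p x ^+ 4)%:E <= \int[P]_x (2^-1 * M p x ^+ 4 + 25 * 50 * V p x ^+ 2)%:E)%E.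
  apply: (le_trans (bound p)); apply: ge0_le_integral_EFin.
  - by move=> x; do ![exact: sqr_ge0|done|apply: addr_ge0|apply: mulr_ge0].
  - by apply: measurable_funD; apply: measurable_funM => //; apply: measurable_funM => //; exact: measurable_funX.
  - by apply: measurable_funD; exact: measurable_funM.
  (* This square gives 48 M^2 V <= M^4 / 2 + 1152 V^2, and 1152 + 64 <= 1250 = 25 * 50. *)
  move=> x; have := sqr_ge0 (M p x ^+ 2 - 48 * V p x).
  have -> : (M p x ^+ 2 - 48 * V p x) ^+ 2 = M p x ^+ 4 - 96 * (M p x ^+ 2 * V p x) + 48 ^+ 2 * V p x ^+ 2 by ring.
  have := V20 x; lra.
rewrite (ge0_integral_EFinD P (f := fun x => 2^-1 * M p x ^+ 4) (g := fun x => 25 * 50 * V p x ^+ 2)); last 4 first.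
- by move=> x; rewrite mulr_ge0// invr_ge0.
- by move=> x; rewrite !mulr_ge0.
- by apply: measurable_funM => //; exact: measurable_cst.
- by apply: measurable_funM => //; exact: measurable_cst.
rewrite (ge0_integral_EFinZl P (f := fun x => M p x ^+ 4))// ?invr_ge0//.
rewrite (ge0_integral_EFinZl P (f := fun x => V p x ^+ 2))//.
have := Mfin p.
have : (0 <= \int[P]_x (M p x ^+ 4)%:E)%E by apply: integral_ge0 => x _; rewrite lee_fin.
have : (0 <= \int[P]_x (V p x ^+ 2)%:E)%E by apply: integral_ge0 => x _; rewrite lee_fin.
case: (\int[P]_x (M p x ^+ 4)%:E)%E => // a; case: (\int[P]_x (V p x ^+ 2)%:E)%E => // [v|].
  by rewrite -!EFinM -EFinD !lee_fin => ? ? _; lra.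
by move=> _ _ _ _; rewrite gt0_muley ?lte_fin// leey.
Qed.

End fixed_grid.

(** On a uniform grid of step h, Cauchy-Schwarz gives V^2 <= h^2 J times the sum of b^4, whose mean
    is at most (h J)^2 C = tau^2 C. The bound does not contain [K], so the truncation level may grow
    with J. *)
Lemma martingale_exp4_uniform_le (tau C K : R) (J : nat) (b : nat -> T -> R) :
  0 < tau -> (0 < J)%N ->
  (forall p, sub_measurable_fun (F (p%:R * (tau / J%:R))) (b p)) ->
  (forall p x, `|b p x| <= K) ->
  (forall p, (\int[P]_x (b p x ^+ 4)%:E <= C%:E)%E) ->
  (\int[P]_x ((\sum_(q < J) b q x * (w (q.+1%:R * (tau / J%:R)) x -
      w (q%:R * (tau / J%:R)) x)) ^+ 4)%:E <= (50 * 50 * tau ^+ 2 * C)%:E)%E.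
Proof.
move=> tau0 J0 bF bK bC; set h := tau / J%:R.
have J0' : 0 < J%:R :> R by rewrite ltr0n.
have h0 : 0 < h by rewrite divr_gt0.
pose s (p : nat) : R := p%:R * h.
have s0 : 0 <= s 0%N by rewrite /s mul0r.
have sS p : s p < s p.+1 by rewrite /s ltr_pM2r// ltr_nat.
have sh p : s p.+1 - s p = h by rewrite /s -mulrBl -natrB// subSnn mul1r.
have mb p : measurable_fun setT (b p).
  by apply: sub_measurable_measurable (bF p); rewrite mulr_ge0// ltW.
have mb4 p : measurable_fun setT (fun x => b p x ^+ 4) by exact: measurable_funX.
have b40 p x : 0 <= b p x ^+ 4 by exact: exprn_even_ge0.
apply: (le_trans (martingale_exp4_le s0 sS bF bK J)).
have -> : (50 * 50 * tau ^+ 2 * C)%:E = ((50 * 50)%:E * (tau ^+ 2 * C)%:E)%E by rewrite -EFinM !mulrA.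
apply: lee_wpmul2l => //.
under eq_integral => x _.
  under eq_bigr => q _ do rewrite sh.
  over.
apply: (@le_trans _ _ (\int[P]_x ((h ^+ 2 * J%:R) * \sum_(q < J) b q x ^+ 4)%:E)%E).
  apply: ge0_le_integral_EFin.
  - by move=> x; exact: sqr_ge0.
  - apply: measurable_funX; apply: measurable_sum => q.
    by apply: measurable_funM => //; exact: measurable_funX.
  - by apply: measurable_funM => //; apply: measurable_sum => q; exact: mb4.
  move=> x; rewrite -mulr_sumr exprMn -mulrA ler_wpM2l ?sqr_ge0//.
  apply: (le_trans (sqr_sum_le _)).
  by rewrite ler_wpM2l//; apply: ler_sum => q _; rewrite -exprM.
rewrite (ge0_integral_EFinZl P (f := fun x => \sum_(q < J) b q x ^+ 4)); last 3 first.
- by rewrite mulr_ge0 ?sqr_ge0.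
- by move=> x; apply: sumr_ge0.
- by apply: measurable_sum => q; exact: mb4.
have -> : tau ^+ 2 * C = h ^+ 2 * J%:R * (J%:R * C).
  by rewrite /h; field; rewrite gt_eqF.
rewrite [leRHS]EFinM; apply: lee_wpmul2l; first by rewrite lee_fin mulr_ge0 ?sqr_ge0.
have -> : (\int[P]_x (\sum_(q < J) b q x ^+ 4)%:E = \sum_(q < J) \int[P]_x (b q x ^+ 4)%:E)%E.
  under eq_integral do rewrite -sumEFin.
  rewrite ge0_integral_sum//.
  - by move=> q; exact/measurable_EFinP.
  - by move=> q x _; rewrite lee_fin.
apply: (@le_trans _ _ (\sum_(q < J) C%:E)%E); first by apply: lee_sum.
by rewrite sumEFin lee_fin sumr_const card_ord mulr_natl.
Qed.

End discrete_martingale.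

(** * Limits of random variables *)

Section complete_measure.
Context d (T : measurableType d) (R : realType) (P : probability T R).
Hypothesis cP : measure_is_complete P.

Lemma ae_exists (Q : T -> Prop) : {ae P, forall x, Q x} -> exists x, Q x.
Proof.
move=> [N [mN N0 QN]]; apply: contrapT => /forallNP nQ.
have NT : N = setT by apply/seteqP; split => // x _; apply: QN; exact: nQ.
by move: N0; rewrite NT probability_setT => -[] /eqP; rewrite oner_eq0.
Qed.

Lemma ae_and (Q Q' : T -> Prop) : {ae P, forall x, Q x} -> {ae P, forall x, Q' x} ->
  {ae P, forall x, Q x /\ Q' x}.
Proof. by move=> h h'; apply: filterI. Qed.

Lemma ae_ge0_le_integral_EFin (f g : T -> R) : (forall x, 0 <= f x) ->
  (forall x, 0 <= g x) ->
  measurable_fun setT f -> measurable_fun setT g -> {ae P, forall x, f x <= g x} ->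
  (\int[P]_x (f x)%:E <= \int[P]_x (g x)%:E)%E.
Proof.
move=> f0 g0 mf mg fg; apply: ae_ge0_le_integral => //.
- by move=> x _; rewrite lee_fin.
- exact/measurable_EFinP.
- by move=> x _; rewrite lee_fin.
- exact/measurable_EFinP.
- by apply: filterS fg => x fg _; rewrite lee_fin.
Qed.

(** The limit agrees almost everywhere with the upper limit, which is measurable; completeness
    transfers this to [f] itself. *)
Lemma ae_cvg_measurable (f_ : nat -> T -> R) (f : T -> R) :
  (forall n, measurable_fun setT (f_ n)) -> {ae P, forall x, f_ ^~ x @ \oo --> f x} ->
  measurable_fun setT f.
Proof.
move=> mf ff; apply/measurable_EFinP.
apply: (ae_measurable_fun cP (f := fun x => limn_esup (fun n => (f_ n x)%:E))).
  apply: filterS ff => x ffx _ /=.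
  have h : (f_ n x)%:E @[n --> \oo] --> (f x)%:E by apply: cvg_EFin => //; exact: nearW.
  exact: (cvg_limn_einf_sup h).2.
by apply: measurable_fun_limn_esup => n; exact/measurable_EFinP.
Qed.

Lemma ae_cvg_integral_le (f_ : nat -> T -> R) (f : T -> R) (C : \bar R) :
  (forall n x, 0 <= f_ n x) -> (forall n, measurable_fun setT (f_ n)) ->
  (forall n, (\int[P]_x (f_ n x)%:E <= C)%E) ->
  {ae P, forall x, f_ ^~ x @ \oo --> f x} ->
  measurable_fun setT f /\ (\int[P]_x (f x)%:E <= C)%E.
Proof.
move=> f0 mf fC ff.
have aeE : {ae P, forall x, limn_einf (fun n => (f_ n x)%:E) = (f x)%:E}.
  apply: filterS ff => x ffx.
  have h : (f_ n x)%:E @[n --> \oo] --> (f x)%:E by apply: cvg_EFin => //; exact: nearW.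
  by rewrite is_cvg_limn_einfE; [exact/cvg_lim|apply/cvg_ex; exists (f x)%:E].
have ml : measurable_fun setT (fun x => limn_einf (fun n => (f_ n x)%:E)).
  rewrite (_ : (fun x => _) = (fun x => - limn_esup (fun n => (- f_ n x)%:E))%E); last first.
    apply/funext => x; rewrite -limn_einfN; congr (limn_einf _).
    by apply/funext => n /=; rewrite opprK.
  apply: measurableT_comp => //; apply: measurable_fun_limn_esup => n.
  by apply/measurable_EFinP; exact: measurableT_comp.
have mfE : measurable_fun setT (EFin \o f).
  apply: (ae_measurable_fun cP) ml.
  by apply: filterS aeE => x + _.
split; first exact/measurable_EFinP.
have -> : (\int[P]_x (f x)%:E = \int[P]_x (limn_einf (fun n => (f_ n x)%:E)))%E.
  apply: ae_eq_integral => //.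
  by apply: filterS aeE => x + _.
apply: (@le_trans _ _ (limn_einf (fun n => \int[P]_x (f_ n x)%:E)%E)).
  apply: fatou => //.
  - by move=> n; apply/measurable_EFinP.
  - by move=> n x _; rewrite lee_fin.
rewrite limn_einf_lim; apply: lime_le.
  exact: is_cvg_einfs.
apply: nearW => n; apply: (le_trans _ (fC n)).
by apply: ereal_inf_lbound; exists n => /=.
Qed.

(** Fatou for the indicators of the intersections of [A] with [A_ n]: they converge to that of [A],
    also outside [A], where nothing is known about [A_ n] alone. *)
Lemma ae_liminf_probability_le (A_ : nat -> set T) (A : set T) (C : \bar R) :
  measurable A -> (forall n, measurable (A_ n)) -> (forall n, P (A_ n) <= C)%E ->
  {ae P, forall x, A x -> \forall n \near \oo, A_ n x} -> (P A <= C)%E.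
Proof.
move=> mA mA_ AC AA.
have e0 (B : set T) x : 0 <= \1_B x :> R by rewrite indicE.
have [] := @ae_cvg_integral_le (fun n => \1_(A `&` A_ n)) (\1_A) C _ _ _ _ => //.
- by move=> n; exact: measurable_indic (measurableI _ _ mA (mA_ n)).
- move=> n; rewrite integral_indic//; last exact: measurableI.
  rewrite setIT; apply: le_trans (AC n); apply: le_measure; rewrite ?inE//.
  exact: measurableI.
- apply: filterS AA => x Ax.
  have [xA|xA] := pselect (A x).
    apply: cvg_near_cst; apply: filterS (Ax xA) => n An.
    by rewrite !indicE !mem_set.
  apply: cvg_near_cst; apply: nearW => n.
  by rewrite !indicE !memNset// => -[].
by rewrite integral_indic// setIT.
Qed.

End complete_measure.

(** * Borel measurability on R^m and elementary norm inequalities *)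

Section borel.
Context (R : realType) (m : nat).

Lemma continuous_measurable_borelV (g : 'rV[R]_m -> R) : continuous g ->
  measurable_fun setT (g : borelV R m -> R).
Proof.
move=> cg; apply: (measurability _ (RGenOInfty.measurableE R)) => // _ [_ [x ->] <-].
rewrite setTI; apply: sub_sigma_algebra.
apply: (@open_comp _ _ g) => //; exact: itv_open.
Qed.

Lemma measurable_coord (i : 'I_m) :
  measurable_fun setT (fun v : borelV R m => (v : 'rV[R]_m) 0 i).
Proof. by apply: continuous_measurable_borelV; exact: coord_continuous. Qed.

Lemma inner_ge0 (v : 'rV[R]_m) : 0 <= inner v v.
Proof. by apply: sumr_ge0 => i _; rewrite -expr2 sqr_ge0. Qed.

Lemma enorm_ge0 (v : 'rV[R]_m) : 0 <= enorm v.
Proof. exact: sqrtr_ge0. Qed.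

Lemma sqr_enorm (v : 'rV[R]_m) : enorm v ^+ 2 = \sum_(i < m) v 0 i ^+ 2.
Proof. by rewrite sqr_sqrtr ?inner_ge0//; apply: eq_bigr => i _; rewrite expr2. Qed.

Lemma normr_coord_le_enorm (v : 'rV[R]_m) i : `|v 0 i| <= enorm v.
Proof.
rewrite -ler_sqr ?nnegrE ?enorm_ge0// real_normK ?num_real// sqr_enorm.
by rewrite (bigD1 i)//= lerDl sumr_ge0// => j _; rewrite sqr_ge0.
Qed.

(** Coordinatewise form of Cauchy-Schwarz; the loss of a factor m is harmless because the final
    constant may depend on m. *)
Lemma normr_inner_le (u v : 'rV[R]_m) : `|inner u v| <= m%:R * (enorm u * enorm v).
Proof.
apply: (le_trans (ler_norm_sum _ _ _)).
apply: (@le_trans _ _ (\sum_(i < m) (enorm u * enorm v))).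
  by apply: ler_sum => i _; rewrite normrM ler_pM// normr_coord_le_enorm.
by rewrite sumr_const card_ord mulr_natl.
Qed.

Lemma measurable_enorm : measurable_fun setT (fun v : borelV R m => enorm (v : 'rV[R]_m)).
Proof.
have mi : measurable_fun setT (fun v : borelV R m => inner (v : 'rV[R]_m) v).
  by apply: measurable_sum => i; apply: measurable_funM; exact: measurable_coord.
have ms : measurable_fun setT (@Num.sqrt R).
  by apply: continuous_measurable_fun; exact: sqrt_continuous.
exact: measurableT_comp ms mi.
Qed.

(** The gradient of a differentiable function may be discontinuous, but it is the pointwise limit of
    the continuous difference quotients with steps 1 / (n + 1). *)
Lemma measurable_directional_derivative (phi : 'rV[R]_m -> R) (v : 'rV[R]_m) :
  (forall x, differentiable phi x) ->
  measurable_fun setT (fun x : borelV R m => 'D_v phi (x : 'rV[R]_m)).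
Proof.
move=> dphi.
have cphi : continuous phi by move=> x; exact: differentiable_continuous.
pose h (n : nat) : R := n.+1%:R^-1.
apply: (@measurable_fun_cvg _ _ _ _
  (fun n (x : borelV R m) => (h n)^-1 * (phi (h n *: v + (x : 'rV[R]_m)) - phi x))).
  move=> n; apply: measurable_funM => //; apply: measurable_funB.
    apply: (@continuous_measurable_borelV (fun x => phi (h n *: v + x))) => x.
    apply: (cvg_comp (fun x => h n *: v + x) phi _ (cphi _)).
    by apply: (@continuousD _ _ _ (cst _) id) => //; exact: cst_continuous.
  exact: continuous_measurable_borelV.
move=> x _.
have hD : derivable phi (x : 'rV[R]_m) v by exact: diff_derivable.
have h0 : h @ \oo --> (0 : R)^'.
  move=> A nA; have hn : \forall n \near \oo, h n != 0 -> A (h n).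
    exact: (@cvg_harmonic R _ nA).
  apply: (filterS _ hn) => n; apply.
  by rewrite gt_eqF// invr_gt0 ltr0n.
exact: (cvg_comp _ _ h0 hD).
Qed.

End borel.

(** * Sums over a grid along a path *)

Section paths.
Context (R : realType).
Implicit Types (p : R -> R) (t h : R).

Lemma within_continuous_dist (V : normedModType R) (p : R -> V) t (e : R) :
  {within `[0, +oo[, continuous p} -> 0 <= t -> 0 < e ->
  exists2 r : R, 0 < r & forall s, 0 <= s -> `|s - t| < r -> `|p s - p t| < e.
Proof.
move=> /subspace_continuousP/(_ t) cp t0 e0.
have /cp/cvgrPdist_lt/(_ _ e0) : `[0, +oo[%classic t by rewrite /= in_itv/= t0.
move=> [r /= r0 hr]; exists r => // s s0 st; rewrite distrC; apply: hr => /=.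
  by rewrite distrC.
by rewrite in_itv/= s0.
Qed.

Lemma within_continuous_coord m (v : R -> 'rV[R]_m) i :
  {within `[0, +oo[, continuous v} ->
  {within `[0, +oo[, continuous (fun s => v s 0 i)}.
Proof.
move=> /subspace_continuousP cv; apply/subspace_continuousP => x x0.
apply: (cvg_comp v (fun u : 'rV[R]_m => u 0 i) (cv x x0)); exact: coord_continuous.
Qed.

(* The sum telescopes to the first grid point [k * h] after [t]. *)
Lemma telescope_before p t h (J : nat) : 0 < h -> 0 <= t -> t <= J%:R * h ->
  exists k : nat, [/\
    \sum_(q < J) (q%:R * h < t)%R%:R * (p (q.+1%:R * h) - p (q%:R * h)) = p (k%:R * h) - p 0,
    t <= k%:R * h & k%:R * h < t + h].
Proof.
move=> h0 t0.
(* Generalization over the number n of summands: either all of the first n steps start before t, so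
   k = n, or the stopping index k has already been reached. *)
suff H n : exists k : nat, [/\ (k <= n)%N,
    \sum_(q < n) (q%:R * h < t)%R%:R * (p (q.+1%:R * h) - p (q%:R * h)) = p (k%:R * h) - p 0,
    k = n \/ t <= k%:R * h & k%:R * h < t + h].
  move=> tJ; have [k [kJ E kt kth]] := H J; exists k; split => //.
  by case: kt => // ->.
elim: n => [|n [k [kn E kt kth]]].
  exists 0%N; split => //; first by rewrite big_ord0 mul0r subrr.
    by left.
  by rewrite mul0r ltr_wpDl.
rewrite big_ord_recr/= E.
have [nt|tn] := ltP (n%:R * h) t.
  have kE : k = n.
    case: kt => // tk; apply/eqP; rewrite eqn_leq kn/= leqNgt; apply/negP => kn'.
    have : k%:R * h <= n%:R * h by rewrite ler_pM2r// ler_nat.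
    by move=> /(le_trans tk); rewrite leNgt nt.
  subst k; exists n.+1; split => //; first by rewrite mul1r; ring.
    by left.
  by rewrite -natr1 mulrDl mul1r ltrD2r.
exists k; split => //; first exact: leqW.
  by rewrite mul0r addr0.
by right; case: kt => // ->.
Qed.

Lemma telescope_before_cvg p t (tau : R) : {within `[0, +oo[, continuous p} ->
  0 < tau -> 0 <= t -> t <= tau ->
  (fun J : nat => \sum_(q < J.+1) (q%:R * (tau / J.+1%:R) < t)%R%:R *
     (p (q.+1%:R * (tau / J.+1%:R)) - p (q%:R * (tau / J.+1%:R)))) @ \oo --> p t - p 0.
Proof.
move=> cp tau0 t0 tt; apply/cvgrPdist_lt => e e0.
have [r r0 hr] := within_continuous_dist cp t0 e0.
have : \forall J \near \oo, tau * J.+1%:R^-1 < r.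
  have /cvgrPdist_lt/(_ _ (divr_gt0 r0 tau0)) := @cvg_harmonic R.
  apply: filterS => J; rewrite /= sub0r normrN gtr0_norm ?invr_gt0//.
  by rewrite ltr_pdivlMr// mulrC.
apply: filterS => J hJ; set h := tau / J.+1%:R.
have h0 : 0 < h by rewrite divr_gt0.
have tJ : t <= J.+1%:R * h by rewrite /h mulrC divfK.
have [k [-> tk kth]] := telescope_before p h0 t0 tJ.
rewrite distrC opprB addrA subrK; apply: hr; first exact: le_trans tk.
rewrite ger0_norm ?subr_ge0// ltrBlDl; by apply: (lt_trans kth); rewrite ltrD2l.
Qed.

Section grid.
Variables (N : nat) (t : nat -> R) (tau : R).
Hypothesis t0 : t 0%N = 0.
Hypothesis tS : forall n, (n < N)%N -> t n < t n.+1.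
Hypothesis tN : forall n, (N <= n)%N -> t n = tau.

(* [last_grid_time N tg s w] unfolds to [last_before (N w) (tg ^~ w) s]. *)
Definition last_before s : R := \big[Num.max/0]_(n < N.+1 | t n <= s) t n.

Lemma grid_nondecreasing n k : (n <= k)%N -> t n <= t k.
Proof.
move=> /subnK <-; elim: (k - n)%N => // j ih; apply: (le_trans ih).
rewrite addSn; have [jN|Nj] := ltnP (j + n) N; first exact/ltW/tS.
by rewrite !tN// leqW.
Qed.

Lemma grid_ge0 n : 0 <= t n. Proof. by rewrite -t0 grid_nondecreasing. Qed.

Lemma grid_le n : t n <= tau.
Proof.
by rewrite -(tN (leq_maxl N n)); apply: grid_nondecreasing; exact: leq_maxr.
Qed.

Lemma grid_locate s : 0 <= s -> s < tau -> exists n, [/\ (n < N)%N, t n <= s & s < t n.+1].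
Proof.
move=> s0 st.
have ex : exists n, s < t n by exists N; rewrite tN.
have [n sn mn] := ex_minnP ex.
case: n sn mn => [|n] sn mn; first by move: sn; rewrite t0 ltNge s0.
exists n; split => //.
  rewrite ltnNge; apply/negP => Nn; have := mn n; rewrite tN// => /(_ st).
  by rewrite ltnn.
by rewrite leNgt; apply/negP => /mn; rewrite ltnn.
Qed.

Lemma last_beforeE s n : (n < N)%N -> t n <= s -> s < t n.+1 -> last_before s = t n.
Proof.
move=> nN tns stn; apply/eqP; rewrite eq_le; apply/andP; split.
  apply: bigmax_le; first exact: grid_ge0.
  move=> k tks; apply: grid_nondecreasing; rewrite leqNgt; apply/negP => nk.
  have := grid_nondecreasing nk; rewrite leNgt => /negP; apply.
  exact: le_lt_trans stn.
have nN' : (n < N.+1)%N by exact: leqW.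
exact: (le_bigmax_cond _ (fun k : 'I_N.+1 => t k) (j := Ordinal nN')).
Qed.

(** Writes a step function through the indicators s < t_n, each of which turns an increment sum into
    a telescoping one. *)
Lemma last_before_sum (a : R -> R) s : 0 <= s -> s < tau ->
  a (last_before s) = \sum_(n < N) a (t n) * ((s < t n.+1)%R%:R - (s < t n)%R%:R).
Proof.
move=> s0 st; have [n [nN tns stn]] := grid_locate s0 st.
rewrite (last_beforeE nN tns stn) (bigD1 (Ordinal nN))//= stn ltNge tns/= subr0 mulr1.
rewrite big1 ?addr0// => k kn.
have : (k < n)%N || (n < k)%N by rewrite -neq_ltn.
move=> /orP[kn'|nk].
  rewrite !ltNge (le_trans _ tns) ?grid_nondecreasing//.
  by rewrite (le_trans _ tns) ?grid_nondecreasing ?(ltnW kn')// subrr mulr0.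
rewrite (lt_le_trans stn) ?grid_nondecreasing// ?(leq_trans nk)//.
by rewrite (lt_le_trans stn) ?grid_nondecreasing// subrr mulr0.
Qed.

(** The path p need not have bounded variation. Convergence holds because the integrand is a step
    function with finitely many jumps: the sum is a finite combination of telescoping sums, each
    converging by continuity of p alone. *)
Lemma riemann_sum_cvg p (a : R -> R) : {within `[0, +oo[, continuous p} -> 0 < tau ->
  (fun J : nat => \sum_(q < J.+1)
     (let z := a (last_before (q%:R * (tau / J.+1%:R))) in if `|z| <= J%:R then z else 0) *
     (p (q.+1%:R * (tau / J.+1%:R)) - p (q%:R * (tau / J.+1%:R)))) @ \oo -->
  \sum_(n < N) a (t n) * (p (t n.+1) - p (t n)).
Proof.
move=> cp tau0.
have cS : (fun J : nat => \sum_(n < N) a (t n) *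
    (\sum_(q < J.+1) (q%:R * (tau / J.+1%:R) < t n.+1)%R%:R *
       (p (q.+1%:R * (tau / J.+1%:R)) - p (q%:R * (tau / J.+1%:R))) -
     \sum_(q < J.+1) (q%:R * (tau / J.+1%:R) < t n)%R%:R *
       (p (q.+1%:R * (tau / J.+1%:R)) - p (q%:R * (tau / J.+1%:R))))) @ \oo -->
   \sum_(n < N) a (t n) * (p (t n.+1) - p (t n)).
  rewrite [X in _ --> X](_ : _ = \sum_(n < N) a (t n) * ((p (t n.+1) - p 0) - (p (t n) - p 0))); last first.
    by apply: eq_bigr => n _; congr (_ * _); ring.
  apply: cvg_big => [|n _]; first exact: add_continuous.
  apply: cvgMl_tmp; apply: cvgB; apply: telescope_before_cvg => //;
    by [exact: grid_ge0|exact: grid_le].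
have [A hA] : exists A : nat, forall n, (n < N)%N -> `|a (t n)| <= A%:R.
  exists (Num.truncn (\sum_(n < N) `|a (t n)|)).+1 => n nN.
  apply: (@le_trans _ _ (\sum_(n < N) `|a (t n)|)).
    by rewrite (bigD1 (Ordinal nN))//= lerDl sumr_ge0.
  exact/ltW/truncnS_gt.
apply: cvg_trans cS; apply: near_eq_cvg.
(* From J >= A on, the truncation at level J no longer acts on this path. *)
exists A => // J /= AJ.
under [RHS]eq_bigr => q _.
  have s0 : 0 <= q%:R * (tau / J.+1%:R) by rewrite mulr_ge0// divr_ge0// ltW.
  have st : q%:R * (tau / J.+1%:R) < tau.
    by rewrite mulrCA gtr_pMr// ltr_pdivrMr// mul1r ltr_nat.
  have [n [nN tns stn]] := grid_locate s0 st.
  have -> : (if `|a (last_before (q%:R * (tau / J.+1%:R)))| <= J%:R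
     then a (last_before (q%:R * (tau / J.+1%:R))) else 0) =
     a (last_before (q%:R * (tau / J.+1%:R))).
    rewrite /= (last_beforeE nN tns stn) ifT//.
    by apply: (le_trans (hA _ nN)); rewrite ler_nat.
  rewrite last_before_sum// mulr_suml.
  over.
rewrite [RHS]exchange_big/=; apply: eq_bigr => n _.
rewrite -sumrB mulr_sumr; apply: eq_bigr => q _; ring.
Qed.

End grid.
End paths.

(** * Adapted processes on random grids *)

Section filtration_facts.
Context (R : realType) (d : measure_display) (Omega : measurableType d)
  (P : probability Omega R) (F : R -> set (set Omega)).
Hypothesis nF : normal_filtration P F.

Lemma normal_filtration_complete : measure_is_complete P.
Proof.
case: nF => [h1 _ _ h4] A /h4 FA.
by have [_] := h1 0 (lexx _); apply.
Qed.

Lemma filtration_sigma_algebra t : 0 <= t -> sigma_algebra setT (F t).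
Proof. by case: nF => [h1 _ _ _] /h1[]. Qed.

Lemma filtration_measurable t : 0 <= t -> F t `<=` measurable.
Proof. by case: nF => [h1 _ _ _] /h1[]. Qed.

Lemma sigma_algebra_measurableE (G : set (set Omega)) A : sigma_algebra setT G ->
  G A = measurable (A : set (g_sigma_algebraType G)).
Proof. by move=> sG; rewrite /measurable/= sigma_algebra_id. Qed.

Lemma filtrationI t A B : 0 <= t -> F t A -> F t B -> F t (A `&` B).
Proof.
move=> /filtration_sigma_algebra st; rewrite !(sigma_algebra_measurableE _ st).
exact: measurableI.
Qed.

Lemma filtration_bigcup t (A : nat -> set Omega) : 0 <= t -> (forall n, F t (A n)) ->
  F t (\bigcup_n A n).
Proof. by move=> /filtration_sigma_algebra[_ _ h] /h. Qed.

(** All negligible sets lie in [F 0], hence in [F t], so events may be altered on them. This is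
    needed because the grid has its structure only almost surely. *)
Lemma filtration_ae t A B : 0 <= t -> F t A -> {ae P, forall w, A w <-> B w} -> F t B.
Proof.
move=> t0 FA [N [mN N0 AB]].
have FN C : C `<=` N -> F t C.
  move=> CN; case: (nF) => [_ h2 _ h4]; apply: (h2 0 t) => //; apply: h4.
  by exists N.
have -> : B = (A `\` N) `|` (B `&` N).
  apply/seteqP; split => w.
    have [Nw|Nw] := pselect (N w); first by right.
    move=> Bw; left; split => //; apply: contrapT => nAw; apply: Nw; apply: AB => /= -[_ h].
    exact/nAw/h.
  move=> [[Aw Nw]|[]//]; apply: contrapT => nBw; apply: Nw; apply: AB => /= -[h _].
  exact/nBw/h.
have st := filtration_sigma_algebra t0.
move: FA (FN N (@subset_refl _ _)) (FN (B `&` N) (@subIsetr _ _ _)).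
rewrite !(sigma_algebra_measurableE _ st) => mA mN' mBN.
by apply: measurableU => //; exact: measurableD.
Qed.

Lemma sub_measurable_comp d1 d2 (U : measurableType d1) (V : measurableType d2)
  (G : set (set Omega)) (g : U -> V) (f : Omega -> U) :
  measurable_fun setT g -> sub_measurable_fun G f -> sub_measurable_fun G (g \o f).
Proof.
move=> mg mf B mB; rewrite comp_preimage; apply: mf.
by rewrite -[X in measurable X]setTI; exact: mg.
Qed.

Lemma adapted_sub_measurable m (I : set R) (X : R -> Omega -> 'rV[R]_m) t :
  adapted_on F I X -> I t -> sub_measurable_fun (F t) (X t : Omega -> borelV R m).
Proof. by move=> aX It B mB; exact: aX. Qed.

Section brownian_coordinates.
Context (m : nat) (W : R -> Omega -> 'rV[R]_m).
Hypothesis bW : brownian_motion P F W.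

Lemma brownian_coord_adapted (i : 'I_m) t : 0 <= t ->
  sub_measurable_fun (F t) (fun w => W t w 0 i).
Proof.
move=> t0; case: bW => aW _ _ _ _.
apply: (sub_measurable_comp (@measurable_coord R m i)).
by apply: adapted_sub_measurable aW _; rewrite /= in_itv/= t0.
Qed.

Lemma brownian_coord_increment (i : 'I_m) (s t : R) (A : set Omega) (B : set R) :
  0 <= s -> s < t -> F s A -> measurable B ->
  P (A `&` (fun w => W t w 0 i - W s w 0 i) @^-1` B) =
  (P A * normal_prob 0 (Num.sqrt (t - s)) B)%E.
Proof.
move=> s0 st FA mB; case: bW => _ _ _ indep law.
pose B' : set (borelV R m) := (fun v : 'rV[R]_m => v 0 i) @^-1` B.
have mB' : measurable B'.
  by rewrite -[B']setTI; exact: measurable_coord.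
pose D := (fun w => W t w - W s w) @^-1` B'.
have DE : D = (fun w => W t w 0 i - W s w 0 i) @^-1` B.
  by apply/seteqP; split => w; rewrite /D /B' /= !mxE.
rewrite -DE (indep _ _ _ _ s0 st FA mB'); congr (_ * _)%E.
(* The other coordinates are left free and contribute factors 1 to the product law. *)
have := law s t (fun j => if j == i then B else setT) s0 st.
rewrite (bigD1 i)//= eqxx big1; last first.
  move=> j ji; rewrite (negbTE ji).
  exact: (@probability_setT _ _ _ (normal_prob 0 (Num.sqrt (t - s)))).
rewrite mule1 => <-; last by move=> j; case: ifPn.
congr (P _); apply/seteqP; split => w /=.
  by move=> Bw j; case: ifPn => // /eqP ->.
by move=> /(_ i); rewrite eqxx.
Qed.

Lemma brownian_coord_paths (i : 'I_m) :
  {ae P, forall w, {within `[0, +oo[, continuous (fun t => W t w 0 i)}}.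
Proof.
case: bW => _ _ cW _ _; apply: filterS cW => w cw.
exact: within_continuous_coord.
Qed.

End brownian_coordinates.

Lemma sup_moment_le m (n : nat) (T C : R) (Z : R -> Omega -> 'rV[R]_m) t :
  (sup_moment P n%:R T Z <= C%:E)%E -> 0 <= t <= T ->
  (\int[P]_w (enorm (Z t w) ^+ n)%:E <= C%:E)%E.
Proof.
move=> h tT; apply: le_trans h; rewrite /sup_moment.
have -> : (\int[P]_w (enorm (Z t w) ^+ n)%:E = 'E_P[fun w => (enorm (Z t w) `^ n%:R)%R])%E.
  rewrite unlock; apply: eq_integral => w _.
  by rewrite powR_mulrn// enorm_ge0.
by apply: ereal_sup_ubound; exists t => //=; rewrite in_itv.
Qed.

Section random_grid.
Context (m : nat) (T : R) (N : Omega -> nat) (tg : nat -> Omega -> R)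
  (Z : R -> Omega -> 'rV[R]_m) (z0 : 'rV[R]_m).
Hypotheses (gT : time_grid P F T N tg)
  (nZ : numerical_approximation P F T tg z0 Z).

(** Up to a null set the event is the union over n of: Z at t_n lies in B, and t_n <= s < t_(n+1).
    Each piece is in [F s] because both Z at t_n and t_(n+1) are known at time t_n. *)
Lemma last_grid_value_measurable s : 0 <= s -> s < T ->
  sub_measurable_fun (F s)
    ((fun w => Z (last_grid_time N tg s w) w) : Omega -> borelV R m).
Proof.
move=> s0 sT B mB; case: gT => [gae gst _]; case: nZ => [_ _ Zst].
apply: (@filtration_ae s (\bigcup_n
   (((fun w => Z (tg n w) w) @^-1` B `&` [set w | tg n w <= s]) `&`
    (tg n.+1 @^-1` `]s, +oo[ `&` [set w | tg n w <= s])))) => //.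
  apply: filtration_bigcup => // n; apply: filtrationI => //.
    exact: (Zst n B mB).2.
  exact: (gst n _ (measurable_itv _)).2.
apply: filterS gae => w [N0 t0 tS tN]; split.
  move=> [n _ [[/= ZB tns] [/= + _]]]; rewrite in_itv/= andbT => stn.
  (* For n >= N the grid time is T, which exceeds s; this is where s < T is needed. *)
  have nN : (n < N w)%N.
    by rewrite ltnNge; apply/negP => /tN tnT; move: tns; rewrite tnT leNgt sT.
  rewrite (_ : last_grid_time N tg s w = tg n w)//.
  exact: (@last_beforeE _ _ (tg ^~ w) _ t0 tS tN).
move=> /= ZB; have [n [nN tns stn]] := grid_locate t0 tN s0 sT.
exists n => //; split; split => //=; last by rewrite in_itv/= stn.
rewrite -(_ : last_grid_time N tg s w = tg n w)//.
exact: (@last_beforeE _ _ (tg ^~ w) _ t0 tS tN).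
Qed.

(** On a nonrandom grid the last grid time before s is almost surely a constant, so the bound at
    that fixed time applies; on a random grid the bound is the second premise. *)
Lemma last_grid_moment (n : nat) (C : R) s :
  (sup_moment P n%:R T Z <= C%:E)%E ->
  (~ nonrandom_grid P tg ->
    sup_moment P n%:R T (fun t w => Z (last_grid_time N tg t w) w) <= C%:E)%E ->
  0 <= s -> s < T ->
  (\int[P]_w (enorm (Z (last_grid_time N tg s w) w) ^+ n)%:E <= C%:E)%E.
Proof.
move=> hC hr s0 sT.
have [[u hu]|nr] := pselect (nonrandom_grid P tg); last first.
  exact: (sup_moment_le (t := s) (hr nr)) (introT andP (conj s0 (ltW sT))).
have [gae _ _] := gT.
have aeu : {ae P, forall w, forall n, tg n w = u n} by exact: ae_foralln.
have good := ae_and gae aeu.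
(* A single good outcome determines the index k for almost all outcomes. *)
have [w1 [[N1 t1 tS1 tN1] e1]] := ae_exists good.
have [k [kN tks stk]] := grid_locate t1 tN1 s0 sT.
have uk : 0 <= u k <= T.
  by rewrite -(e1 k) (grid_ge0 t1 tS1 tN1) (grid_le tS1 tN1).
apply: le_trans (sup_moment_le hC uk).
have [_ aZ _] := nZ.
apply: ae_ge0_le_integral_EFin.
- by move=> w; rewrite exprn_ge0// enorm_ge0.
- by move=> w; rewrite exprn_ge0// enorm_ge0.
- apply: measurable_funX; apply: (measurableT_comp (@measurable_enorm R m)).
  apply: (sub_measurable_measurable _ s0 (last_grid_value_measurable s0 sT)).
  by move=> t t0; split; [exact: filtration_sigma_algebra|exact: filtration_measurable].
- apply: measurable_funX; apply: (measurableT_comp (@measurable_enorm R m)).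
  have uk0 : 0 <= u k by case/andP: uk.
  apply: (sub_measurable_measurable _ uk0 (adapted_sub_measurable aZ _)); last by rewrite /= in_itv.
  by move=> t t0; split; [exact: filtration_sigma_algebra|exact: filtration_measurable].
apply: filterS good => w [[Nw t0 tS tN] e].
suff -> : last_grid_time N tg s w = u k by [].
rewrite -(e k); apply: (@last_beforeE _ _ (tg ^~ w) _ t0 tS tN).
- rewrite ltnNge; apply/negP => /tN; rewrite e -(e1 k) => tkT.
  by move: tks; rewrite tkT leNgt sT.
- by rewrite e -(e1 k).
- by rewrite e -(e1 k.+1).
Qed.

End random_grid.
End filtration_facts.

(* The product of indicators stops the walk [x] at its first exit from [-a, a]. *)
Lemma stopped_sum (R : realType) (x : nat -> R) (a : R) n : x 0%N = 0 -> 0 <= a ->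
  let S := \sum_(q < n) (\prod_(r < q.+1) \1_(`[- a, a]%classic) (x r)) * (x q.+1 - x q) in
  ((forall r, (r <= n)%N -> `|x r| <= a) /\ S = x n) \/
  ((exists2 r, (r <= n)%N & a < `|x r|) /\ a < `|S|).
Proof.
move=> x0 a0 /=.
have ind (z : R) : \1_(`[- a, a]%classic) z = (`|z| <= a)%R%:R :> R.
  by rewrite indicE; congr (_%:R); rewrite mem_setE in_itv/= ler_norml.
elim: n => [|n [[xa E]|[[r rn ar] aS]]].
- left; split; last by rewrite big_ord0.
  by move=> r; rewrite leqn0 => /eqP ->; rewrite x0 normr0.
- rewrite big_ord_recr/= E big1 => [|r _]; last by rewrite ind xa// -ltnS.
  rewrite mul1r subrKC; have [xSa|axS] := leP `|x n.+1| a.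
    left; split => // r; rewrite leq_eqVlt => /predU1P[->//|]; exact: xa.
  by right; split => //; exists n.+1.
- right; split; first by exists r => //; exact: leqW.
  have rn' : (r < n.+1)%N by [].
  rewrite big_ord_recr/= (bigD1 (Ordinal rn'))//= ind leNgt ar/= !mul0r addr0.
  exact: aS.
Qed.

(** * Sums against the Brownian motion on random grids, and its exit from a small ball *)

Section stochastic_sums.
Context (R : realType) (d : measure_display) (Omega : measurableType d)
  (P : probability Omega R) (F : R -> set (set Omega)).
Hypothesis nF : normal_filtration P F.
Context (m : nat) (W : R -> Omega -> 'rV[R]_m).
Hypothesis bW : brownian_motion P F W.

Let FP t : 0 <= t -> sigma_algebra setT (F t) /\ F t `<=` measurable.
Proof.
by move=> t0; split; [exact: (filtration_sigma_algebra nF)|exact: (filtration_measurable nF)].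
Qed.

Let Fmono s t : 0 <= s -> s <= t -> F s `<=` F t.
Proof. by case: nF => _ + _ _; exact. Qed.

Let wF i t : 0 <= t -> sub_measurable_fun (F t) (fun w => W t w 0 i).
Proof. exact: (brownian_coord_adapted bW). Qed.

Let mW i t : 0 <= t -> measurable_fun setT (fun w => W t w 0 i).
Proof. by move=> t0; exact: (sub_measurable_measurable FP t0 (wF i t0)). Qed.

Let bound (i : 'I_m) := @martingale_exp4_uniform_le _ _ _ P F (fun t w => W t w 0 i)
  FP Fmono (wF i) (fun s t A B => @brownian_coord_increment _ _ _ _ _ _ _ bW i s t A B).

Lemma stochastic_sum_exp4_le (T C : R) (N : Omega -> nat) (tg : nat -> Omega -> R)
  (Z : R -> Omega -> 'rV[R]_m) (z0 : 'rV[R]_m) (i : 'I_m) :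
  0 < T -> time_grid P F T N tg -> numerical_approximation P F T tg z0 Z ->
  (forall s, 0 <= s -> s < T ->
    (\int[P]_w (enorm (Z (last_grid_time N tg s w) w) ^+ 4)%:E <= C%:E)%E) ->
  let I w := \sum_(n < N w) Z (tg n w) w 0 i * (W (tg n.+1 w) w 0 i - W (tg n w) w 0 i) in
  measurable_fun setT I /\ (\int[P]_w (I w ^+ 4)%:E <= (50 * 50 * T ^+ 2 * C)%:E)%E.
Proof.
move=> T0 gT nZ hC I.
pose clip (J : nat) (z : R) := if `|z| <= J%:R then z else 0.
have mclip J : measurable_fun setT (clip J).
  rewrite (_ : clip J = fun z => z * \1_(`[- J%:R, J%:R]%classic) z).
    by apply: measurable_funM => //; exact: measurable_indic.
  apply/funext => z; rewrite /clip indicE mem_setE in_itv/= -ler_norml.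
  by case: ifPn; rewrite ?mulr1 ?mulr0.
pose Zl s w := Z (last_grid_time N tg s w) w.
pose h (J : nat) : R := T / J.+1%:R.
have h0 J : 0 < h J by rewrite divr_gt0.
(* The fixed grid bound wants weights for every q, while the value at the last grid time is
   controlled only before T; beyond that the weight is 0. *)
pose b J q w := if (q < J.+1)%N then clip J (Zl (q%:R * h J) w 0 i) else 0.
have qh0 J q : 0 <= q%:R * h J by rewrite mulr_ge0// ltW.
have qhT J q : (q < J.+1)%N -> q%:R * h J < T.
  by move=> qJ; rewrite mulrCA gtr_pMr// ltr_pdivrMr// mul1r ltr_nat.
have bF J q : sub_measurable_fun (F (q%:R * h J)) (b J q).
  have [qJ|qJ] := boolP (q < J.+1)%N.
    rewrite (_ : b J q = clip J \o (fun w => Zl (q%:R * h J) w 0 i)); last first.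
      by apply/funext => w; rewrite /b qJ.
    apply: (sub_measurable_comp (mclip J)).
    exact: (sub_measurable_comp (@measurable_coord R m i)
      (last_grid_value_measurable nF gT nZ (qh0 J q) (qhT J q qJ))).
  rewrite (_ : b J q = cst 0); last by apply/funext => w; rewrite /b (negbTE qJ).
  apply: (proj2 (sub_measurable_funP (FP (qh0 J q)).1 _)); exact: measurable_cst.
have bK J q w : `|b J q w| <= J%:R.
  rewrite /b /clip; case: ifPn => // _; last by rewrite normr0.
  by case: ifPn => // _; rewrite normr0.
have C0 : 0 <= C.
  rewrite -lee_fin; apply: le_trans (hC 0 (lexx _) T0).
  by apply: integral_ge0 => w _; rewrite lee_fin exprn_ge0// enorm_ge0.
have mb J q : measurable_fun setT (b J q).
  exact: (sub_measurable_measurable FP (qh0 J q) (bF J q)).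
have bC J q : (\int[P]_w (b J q w ^+ 4)%:E <= C%:E)%E.
  have [qJ|qJ] := boolP (q < J.+1)%N; last first.
    rewrite integral0_eq ?lee_fin// => w _.
    by rewrite /b (negbTE qJ) expr0n.
  apply: le_trans (hC _ (qh0 J q) (qhT J q qJ)); apply: ge0_le_integral_EFin.
  - by move=> w; exact: exprn_even_ge0.
  - exact: measurable_funX.
  - apply: measurable_funX; apply: (measurableT_comp (@measurable_enorm R m)).
    apply: (sub_measurable_measurable FP (qh0 J q)).
    exact: (last_grid_value_measurable nF gT nZ (qh0 J q) (qhT J q qJ)).
  move=> w; rewrite -[leLHS]ger0_norm ?exprn_even_ge0// normrX lerXn2r ?nnegrE ?enorm_ge0//.
  rewrite /b qJ /clip; apply: le_trans (normr_coord_le_enorm _ i).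
  by case: ifPn; rewrite // normr0.
pose f J w := \sum_(q < J.+1) b J q w *
   (W (q.+1%:R * h J) w 0 i - W (q%:R * h J) w 0 i).
have mf J : measurable_fun setT (f J).
  by apply: measurable_sum => q; apply: measurable_funM => //; apply: measurable_funB; exact: mW.
have cf : {ae P, forall w, f ^~ w @ \oo --> I w}.
  have [gae _ _] := gT.
  apply: filterS (ae_and gae (brownian_coord_paths bW i)) => w [[N0 t0 tS tN] cw].
  have := riemann_sum_cvg t0 tS tN (a := fun s => Z s w 0 i) cw T0.
  apply: cvg_trans; apply: near_eq_cvg; apply: nearW => J.
  by apply: eq_bigr => q _; rewrite /b ltn_ord.
have mI : measurable_fun setT I := ae_cvg_measurable (normal_filtration_complete nF) mf cf.
split => //.
have [] // := @ae_cvg_integral_le _ _ _ P (normal_filtration_complete nF)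
  (fun J w => f J w ^+ 4) (fun w => I w ^+ 4) (50 * 50 * T ^+ 2 * C)%:E.
- by move=> J w; exact: exprn_even_ge0.
- by move=> J; exact: measurable_funX.
- by move=> J; exact: (bound i T0 _ (bF J) (bK J) (bC J)).
- apply: filterS cf => w cw.
  rewrite (_ : I w ^+ 4 = I w * I w * (I w * I w)); last by ring.
  rewrite (_ : (fun J => f J w ^+ 4) = (fun J => f J w * f J w * (f J w * f J w))); last first.
    by apply/funext => J; ring.
  by apply: cvgM; apply: cvgM.
Qed.

(** Takes the place of a maximal inequality: Markov is applied to the fourth power of each
    coordinate walk stopped at its first exit from [-a, a]. The stopped walk is a sum with weights
    in [0, 1], so the martingale bound holds with C = 1, uniformly in J. *)
Lemma brownian_exit_sets (T a : R) : 0 < T -> 0 < a ->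
  exists A : nat -> set Omega, [/\ forall J, measurable (A J),
    forall J, (P (A J) <= (m%:R * (50 * 50 * T ^+ 2) / a ^+ 4)%:E)%E &
    {ae P, forall w, forall J, ~ A J w -> forall i q, (q <= J.+1)%N ->
       `|W (q%:R * (T / J.+1%:R)) w 0 i| <= a}].
Proof.
move=> T0 a0.
pose h (J : nat) : R := T / J.+1%:R.
have h0 J : 0 < h J by rewrite divr_gt0.
have qh0 J q : 0 <= q%:R * h J by rewrite mulr_ge0// ltW.
pose ia (z : R) : R := \1_(`[- a, a]%classic) z.
have mia : measurable_fun setT ia by exact: measurable_indic.
have ia01 z : 0 <= ia z <= 1 by rewrite /ia indicE ler0n lern1 leq_b1.
(* The product runs over r <= q, so the weight of the increment after time q h is known at that
   time. *)
pose b i J q w := \prod_(r < q.+1) ia (W (r%:R * h J) w 0 i).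
have b01 i J q w : 0 <= b i J q w <= 1.
  rewrite prodr_ge0 => [|r _]; last by case/andP: (ia01 (W (r%:R * h J) w 0 i)).
  by rewrite /= prodr_ile1.
have bF i J q : sub_measurable_fun (F (q%:R * h J)) (b i J q).
  apply: (proj2 (sub_measurable_funP (FP (qh0 J q)).1 _)).
  apply: measurable_prod => r _.
  apply: (proj1 (sub_measurable_funP (FP (qh0 J q)).1 _)).
  apply: (sub_measurable_comp mia).
  apply: (sub_measurable_le Fmono (qh0 J r)) (wF i (qh0 J r)).
  by rewrite ler_pM2r// ler_nat -ltnS.
have bK i J q w : `|b i J q w| <= 1.
  by case/andP: (b01 i J q w) => b0 b1; rewrite ger0_norm.
have mb i J q : measurable_fun setT (b i J q).
  exact: (sub_measurable_measurable FP (qh0 J q) (bF i J q)).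
have bC i J q : (\int[P]_w (b i J q w ^+ 4)%:E <= 1%:E)%E.
  rewrite -[leRHS](probability_integral_cst P); apply: ge0_le_integral_EFin => //.
  - by move=> w; exact: exprn_even_ge0.
  - exact: measurable_funX.
  by move=> w; case/andP: (b01 i J q w) => b0 b1; rewrite exprn_ile1.
pose f i J w := \sum_(q < J.+1) b i J q w *
   (W (q.+1%:R * h J) w 0 i - W (q%:R * h J) w 0 i).
have mf i J : measurable_fun setT (f i J).
  by apply: measurable_sum => q; apply: measurable_funM => //; apply: measurable_funB; exact: mW.
pose g J w := \sum_(i < m) f i J w ^+ 4.
have mg J : measurable_fun setT (g J).
  by apply: measurable_sum => i; exact: measurable_funX.
have g0 J w : 0 <= g J w by apply: sumr_ge0 => i _; exact: exprn_even_ge0.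
pose A J := g J @^-1` `[a ^+ 4, +oo[.
have mA J : measurable (A J) by rewrite -[A J]setTI; exact: mg.
exists A; split => //.
- move=> J.
  have -> : P (A J) = (\int[P]_w (\1_(A J) w)%:E)%E by rewrite integral_indic// setIT.
  apply: (@le_trans _ _ (\int[P]_w (a ^- 4 * g J w)%:E)%E).
    apply: ge0_le_integral_EFin => //.
    - exact: measurable_funM.
    move=> w; rewrite indicE; have [|] := boolP (w \in A J).
      rewrite inE /A/= in_itv/= andbT => h1.
      by rewrite mulrC ler_pdivlMr ?exprn_gt0// mul1r.
    by move=> _; rewrite mulr_ge0// invr_ge0 exprn_ge0// ltW.
  rewrite (ge0_integral_EFinZl P (f := g J))//; last by rewrite invr_ge0 exprn_ge0// ltW.
  have -> : (\int[P]_w (g J w)%:E = \sum_(i < m) \int[P]_w (f i J w ^+ 4)%:E)%E.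
    under eq_integral do rewrite -sumEFin.
    rewrite ge0_integral_sum//.
    - by move=> i; apply/measurable_EFinP; exact: measurable_funX.
    - by move=> i w _; rewrite lee_fin exprn_even_ge0.
  rewrite [X in (_ <= X%:E)%E]mulrC EFinM; apply: lee_wpmul2l.
    by rewrite lee_fin invr_ge0 exprn_ge0// ltW.
  apply: (@le_trans _ _ (\sum_(i < m) (50 * 50 * T ^+ 2)%:E)%E).
    apply: lee_sum => i _; rewrite -[X in (_ <= X%:E)%E]mulr1.
    exact: (bound i T0 _ (bF i J) (bK i J) (bC i J)).
  by rewrite sumEFin lee_fin sumr_const card_ord [leRHS]mulr_natl.
- case: bW => _ W0 _ _ _; apply: filterS W0 => w W0 J nA i q qJ.
  have x0 : W (0%:R * h J) w 0 i = 0 by rewrite mul0r W0 mxE.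
  have := @stopped_sum R (fun q => W (q%:R * h J) w 0 i) a J.+1 x0 (ltW a0).
  case=> [[xa _]|[_]]; first exact: xa.
  rewrite -[X in a < `|X|]/(f i J w) => af; exfalso; apply: nA.
  rewrite /A /= in_itv/= andbT.
  apply: (@le_trans _ _ (f i J w ^+ 4)).
    rewrite -[leRHS]ger0_norm ?exprn_even_ge0// normrX lerXn2r ?nnegrE//; exact: ltW.
  by rewrite /g (bigD1 i)//= lerDl sumr_ge0// => j _; exact: exprn_even_ge0.
Qed.

(** Only arbitrarily large J are required, not all large J: this is what remains when an outcome
    fails to lie eventually in the exit sets. Continuity of the path does the rest. *)
Lemma brownian_sup_le (T a : R) (w : Omega) : 0 < T ->
  (forall i, {within `[0, +oo[, continuous (fun t => W t w 0 i)}) ->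
  (forall J0 : nat, exists2 J : nat, (J0 <= J)%N & forall i q, (q <= J.+1)%N ->
       `|W (q%:R * (T / J.+1%:R)) w 0 i| <= a) ->
  forall i t, 0 <= t -> t <= T -> `|W t w 0 i| <= a.
Proof.
move=> T0 cW hJ i t t0 tT; apply/ler_addgt0Pr => e e0.
have [r r0 hr] := within_continuous_dist (cW i) t0 e0.
have [J JJ hq] := hJ (Num.truncn (T / r)).
set h := T / J.+1%:R in hq.
have h0 : 0 < h by rewrite divr_gt0.
have hlt : h < r.
  rewrite /h ltr_pdivrMr// mulrC -ltr_pdivrMr//.
  by apply: (lt_le_trans (truncnS_gt _)); rewrite ler_nat.
have JhT : J.+1%:R * h = T by rewrite mulrC /h divfK.
have tJ : t <= J.+1%:R * h by rewrite JhT.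
have [k [_ tk kth]] := telescope_before (fun=> 0) h0 t0 tJ.
have kJ : (k <= J.+1)%N.
  rewrite -ltnS -(ltr_nat R) -(ltr_pM2r h0); apply: (lt_le_trans kth).
  by rewrite -[X in _ <= X * _]natr1 mulrDl mul1r lerD2r.
have := hr (k%:R * h) (le_trans t0 tk).
rewrite ger0_norm ?subr_ge0// ltrBlDl => /(_ (lt_trans kth _)).
rewrite ltrD2l => /(_ hlt) d1.
have := hq i k kJ.
have := ler_normB (W (k%:R * h) w 0 i) (W (k%:R * h) w 0 i - W t w 0 i).
rewrite opprB subrKC; lra.
Qed.

End stochastic_sums.

(** * The variation process for small times *)

Lemma normr_coord_le (R : realType) m (v : 'rV[R]_m) i : `|v 0 i| <= `|v|.
Proof.
rewrite [X in _ <= X]mx_normrE.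
exact: (le_bigmax_cond _ (fun ij : 'I_1 * 'I_m => `|v ij.1 ij.2|) (j := (0, i))).
Qed.

Lemma normr_le_coord (R : realType) m (v : 'rV[R]_m) c : 0 <= c ->
  (forall i, `|v 0 i| <= c) -> `|v| <= c.
Proof.
move=> c0 h; rewrite [X in X <= _]mx_normrE; apply: bigmax_le => // -[j i] _ /=.
by rewrite ord1.
Qed.

Lemma normr_le_enorm (R : realType) m (v : 'rV[R]_m) : `|v| <= enorm v.
Proof. by apply: normr_le_coord => [|i]; [exact: enorm_ge0|exact: normr_coord_le_enorm]. Qed.

(** The difference quotients in direction v are eventually bounded by k |v|, hence so is their
    limit. *)
Lemma normr_diff_le (R : realType) (V V' : normedModType R) (g : V -> V') (x v : V) (k : R) :
  differentiable g x -> 0 <= k ->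
  (\forall z \near x, `|g z - g x| <= k * `|z - x|) ->
  `|'d g x v| <= k * `|v|.
Proof.
move=> dg k0 hk; rewrite -deriveE//.
have dv : derivable g x v by exact: diff_derivable.
rewrite leNgt; apply/negP => lt1.
have h1 : \forall h \near (0 : R)^', k * `|v| < `|h^-1 *: ((g \o shift x) (h *: v) - g x)|.
  exact: (cvgr_norm_gt _ dv _ lt1).
have h2 : \forall h \near (0 : R)^', `|h^-1 *: ((g \o shift x) (h *: v) - g x)| <= k * `|v|.
  have c : (h *: v + x) @[h --> (0 : R)^'] --> x.
    rewrite -[X in _ --> X]add0r -(scale0r v); apply: cvgD; last exact: cvg_cst.
    apply: cvgZr_tmp; exact: cvg_within.
  have n0 : \forall h \near (0 : R)^', h != 0 by exact: nbhs_dnbhs_neq.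
  apply: filterS (filterI n0 (c _ hk)) => h [/= h0 hh].
  rewrite normrZ normfV mulrC ler_pdivrMr ?normr_gt0//.
  apply: (le_trans hh); rewrite addrK normrZ; lra.
have [h [/= a1 a2]] := filter_ex (filterI h1 h2).
by move: a1; rewrite ltNge a2.
Qed.

Section first_exit.
Context (R : realType).

(** Otherwise take the infimum of the failure set: Q holds before it, so the premise carries Q past
    it, a contradiction. It spares the explicit first exit time. *)
Lemma real_induction (Q : R -> Prop) (T : R) :
  (forall t, 0 <= t -> t <= T -> (forall s, 0 <= s -> s < t -> Q s) ->
    exists2 e, 0 < e & forall s, t <= s -> s < t + e -> Q s) ->
  forall t, 0 <= t -> t <= T -> Q t.
Proof.
move=> h t t0 tT; apply: contrapT => nQt.
pose E := [set s | 0 <= s /\ ~ Q s].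
have Et : E t by [].
have lE : lbound E 0 by move=> s [].
have iE : has_inf E by split; [exists t|exists 0].
have i0 : 0 <= inf E by apply: lb_le_inf => //; exists t.
have gi s : E s -> inf E <= s by apply: ge_inf; exists 0.
have it : inf E <= t by exact: gi.
have [s s0 si|e e0 he] := h (inf E) i0 (le_trans it tT).
  apply: contrapT => nQs; have : inf E <= s by exact: gi.
  by rewrite leNgt si.
have [s [s0 nQs] se] := inf_adherent e0 iE.
exact: (nQs (he s (gi s (conj s0 nQs)) se)).
Qed.

(** The bound is asked only for s < t, since in the continuation argument nothing is known yet at t;
    the endpoint is a null set. *)
Lemma normr_Rintegral_le (g : R -> R) (t K : R) : 0 <= t ->
  lebesgue_measure.-integrable `[0, t] (EFin \o g) ->
  (forall s, 0 <= s -> s < t -> `|g s| <= K) -> 0 <= K ->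
  `|\int[lebesgue_measure]_(s in `[0, t]) g s| <= K * t.
Proof.
move=> t0 ig hg K0.
rewrite -lee_fin EFin_normr_Rintegral//.
apply: (le_trans (le_abse_integral _ _ _)) => //; first exact: measurable_int ig.
have -> : (K * t)%:E = (\int[lebesgue_measure]_(s in `[0%R, t]) K%:E)%E.
  rewrite integral_cst//= lebesgue_measure_itv/= lte_fin.
  have [_|t0'] := ltP 0 t; first by rewrite oppr0 adde0 EFinM.
  have -> : t = 0 by apply/eqP; rewrite eq_le t0 t0'.
  by rewrite mulr0 mule0.
apply: ae_ge0_le_integral => //.
- by apply: measurableT_comp => //; exact: measurable_int ig.
exists [set t]; split => //; first exact: lebesgue_measure_set1.
move=> s /= /not_implyP[]; rewrite in_itv/= => /andP[s0 st] nle.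
apply: contrapT => /eqP snt; apply: nle; rewrite lee_fin; apply: hg => //.
by rewrite lt_neqAle snt.
Qed.

Lemma normr_integralV_le m (g : R -> 'rV[R]_m) (t K : R) : 0 <= t ->
  integrableV g t -> (forall s, 0 <= s -> s < t -> `|g s| <= K) -> 0 <= K ->
  `|integralV g t| <= K * t.
Proof.
move=> t0 ig hg K0; apply: normr_le_coord => [|i]; first exact: mulr_ge0.
rewrite mxE; apply: normr_Rintegral_le => //; first exact: ig.
by move=> s s0 st; apply: le_trans (hg s s0 st); exact: normr_coord_le.
Qed.

End first_exit.

Lemma regular_drift_local_bound (R : realType) m (f : R -> 'rV[R]_m -> 'rV[R]_m)
    (x : 'rV[R]_m) : regular_drift f ->
  exists r K : R, [/\ 0 < r, 0 < K &
    forall z, `|z - x| < r -> [/\ `|f 0 z| <= K, `|dtheta f z| <= K &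
      forall v, `|'d (f 0) z v| <= K * `|v|] ].
Proof.
case=> /(_ 0 x)[U nU lU] df /(_ x)[K1 hK1].
have d0 z : differentiable (f 0) z.
  have -> : f 0 = (fun z : R^o * 'rV[R]_m => f z.1 z.2) \o (fun x => (0 : R^o, x)) by [].
  apply: differentiable_comp; last exact: df.
  apply: differentiable_pair; first exact: differentiable_cst.
  by have [] := @is_diff_id R _ z.
have [k k0 hk] : exists2 k : R, 0 < k & forall a b, U a -> U b -> `|f 0 a - f 0 b| <= k * `|a - b|.
  have h0 : \forall M \near (+oo : set_system R), 0 < M by exists 0; split.
  have [k [/= k0 hk]] := filter_ex (filterI h0 lU).
  by exists k => // a b Ua Ub; exact: (hk (a, b)).
(* Bounding the differential at z needs the Lipschitz estimate on a whole neighbourhood of z, not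
   only at z. *)
have nU' : \forall z \near x, \forall z' \near z, U z' by apply: nbhs_interior.
have /nbhs_normP[r /= r0 hr] : \forall z \near x,
    (\forall z' \near z, U z') /\ enorm (dtheta f z) <= K1 by apply: filterI.
exists r, (k + `|K1| + (`|f 0 x| + k * r)); split => //.
  by rewrite ltr_wpDr ?addr_ge0 ?mulr_ge0// ?ltW// ltr_wpDr.
move=> z zx; have [Uz dz] : (\forall z' \near z, U z') /\ enorm (dtheta f z) <= K1.
  by apply: hr => /=; rewrite distrC.
have Ux : U x by exact: nbhs_singleton.
have Uz' : U z by exact: nbhs_singleton.
have krp : 0 <= k * r by rewrite mulr_ge0// ltW.
split.
- have h1 : `|f 0 z - f 0 x| <= k * r.
    by apply: (le_trans (hk _ _ Uz' Ux)); rewrite ler_wpM2l// ltW.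
  have := ler_normD (f 0 z - f 0 x) (f 0 x); rewrite subrK.
  have := normr_ge0 K1; lra.
- apply: (le_trans (normr_le_enorm _)); apply: (le_trans dz).
  have := ler_norm K1; have := normr_ge0 (f 0 x); lra.
- move=> v; apply: (@le_trans _ _ (k * `|v|)).
    apply: normr_diff_le => //; first exact: ltW.
    by apply: filterS Uz => z' Uz1; exact: hk.
  rewrite ler_wpM2r//; have := normr_ge0 (f 0 x); have := normr_ge0 K1; lra.
Qed.

(** A pathwise continuation argument. While |Y - x0| < r and |y| < 1, the drift of Y is at most K
    and that of y at most L = K + K + S. Since K T <= r / 4, sigma a = r / 4 and L T <= 1 / 2, the
    path then stays within r / 2 and y within 1 / 2, so the constraints are never reached. *)
Lemma variation_small_time (R : realType) m (f : R -> 'rV[R]_m -> 'rV[R]_m)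
    (x0 : 'rV[R]_m) (sigma S : R) : regular_drift f -> 0 < sigma -> 0 < S ->
  exists a L T0 : R, [/\ 0 < a, 0 < L, 0 < T0, T0 <= 1 &
  forall (T : R) (w Y y : R -> 'rV[R]_m), 0 < T -> T <= T0 ->
    {within `[0, +oo[, continuous Y} -> {within `[0, +oo[, continuous y} ->
    (forall t, 0 <= t -> integrableV (fun s => f 0 (Y s)) t /\
       Y t = x0 + integralV (fun s => f 0 (Y s)) t + sigma *: w t) ->
    (let drift s := dtheta f (Y s) + ('d (f 0) (Y s) (y s) - S *: y s) in
     forall t, 0 <= t -> integrableV drift t /\ y t = integralV drift t) ->
    (forall i t, 0 <= t -> t <= T -> `|w t 0 i| <= a) ->
    `|y T| <= L * T].
Proof.
move=> rf sig0 S0; have [r [K [r0 K0 hrK]]] := regular_drift_local_bound x0 rf.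
pose a := r / (4 * sigma); pose L := K + K + S.
have L0 : 0 < L by rewrite !addr_gt0.
pose T0 := Num.min 1 (Num.min (2 * L)^-1 (r / (4 * K))).
have T00 : 0 < T0.
  by rewrite !lt_min ltr01 invr_gt0 mulr_gt0//= divr_gt0// mulr_gt0.
exists a, L, T0; split => //; first by rewrite divr_gt0// mulr_gt0.
  by rewrite ge_min lexx.
move=> T w Y y Tp TT0 cY cy eY ey hw.
have TL : L * T <= 2^-1.
  have : T <= (2 * L)^-1 by apply: (le_trans TT0); rewrite /T0 !ge_min lexx orbT.
  by rewrite invfM ler_pdivlMr// mulrC.
have TK : K * T <= r / 4.
  have : T <= r / (4 * K) by apply: (le_trans TT0); rewrite /T0 !ge_min lexx !orbT.
  by rewrite invfM mulrA ler_pdivlMr// mulrC.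
pose Q s := `|Y s - x0| < r /\ `|y s| < 1.
have key t : 0 <= t -> t <= T -> (forall s, 0 <= s -> s < t -> Q s) ->
    `|Y t - x0| <= r / 2 /\ `|y t| <= L * t.
  move=> t0 tT hQ; split.
    have [iY ->] := eY t t0.
    rewrite -(addrA x0) addrAC subrr add0r; apply: (le_trans (ler_normD _ _)).
    have h1 : `|integralV (fun s => f 0 (Y s)) t| <= K * t.
      apply: normr_integralV_le => //; last exact: ltW.
      by move=> s s0 st; have [/hrK[]] := hQ s s0 st.
    have h2 : `|sigma *: w t| <= r / 4.
      rewrite normrZ gtr0_norm// mulrC -ler_pdivlMr// -mulrA -invfM.
      apply: normr_le_coord => [|i]; last exact: hw.
      by rewrite divr_ge0// ?mulr_ge0// ltW.
    have h3 : K * t <= K * T by rewrite ler_wpM2l// ltW.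
    lra.
  have [iy ->] := ey t t0.
  apply: normr_integralV_le => //; last exact: ltW.
  move=> s s0 st; have [/hrK[_ hd hD] ys] := hQ s s0 st.
  apply: (le_trans (ler_normD _ _)); rewrite /L -addrA lerD//.
  apply: (le_trans (ler_normB _ _)); rewrite lerD//.
    by apply: (le_trans (hD _)); rewrite ler_piMr ?ltW.
  by rewrite normrZ gtr0_norm// ler_piMr ?ltW.
have allQ : forall t, 0 <= t -> t <= T -> Q t.
  apply: real_induction => t t0 tT hQ.
  have [kY ky] := key t t0 tT hQ.
  have ky' : `|y t| <= 2^-1.
    by apply: (le_trans ky); apply: le_trans TL; rewrite ler_wpM2l// ltW.
  (* The margins are r / 3 and 1 / 3, and r / 2 + r / 3 < r, 1 / 2 + 1 / 3 < 1. *)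
  have [e1 e10 h1] := within_continuous_dist cY t0 (divr_gt0 r0 (ltr0Sn R 2)).
  have [e2 e20 h2] := within_continuous_dist cy t0 (divr_gt0 (@ltr01 R) (ltr0Sn R 2)).
  exists (Num.min e1 e2); first by rewrite lt_min e10.
  move=> s ts se; have s0 := le_trans t0 ts.
  have st : `|s - t| < Num.min e1 e2 by rewrite ger0_norm ?subr_ge0// ltrBlDl.
  move: st; rewrite lt_min => /andP[st1 st2]; split.
    have := h1 s s0 st1; have := ler_normD (Y s - Y t) (Y t - x0).
    rewrite addrA subrK; lra.
  have := h2 s s0 st2; have := ler_normD (y s - y t) (y t).
  rewrite subrK; lra.
apply: (key T (ltW Tp) (lexx _) _).2 => s s0 sT.
by apply: allQ => //; exact: ltW.
Qed.

(** * Moment bounds and the two terms of the estimator *)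

Section mean_bounds.
Context d (T : measurableType d) (R : realType) (P : probability T R).
Implicit Types (f g : T -> R) (A B c k : R).

(** Bundles the side conditions of comparing integrals, so that moment bounds can be added and
    scaled like numbers. *)
Definition mean_le f A := [/\ measurable_fun setT f, forall x, 0 <= f x &
  (\int[P]_x (f x)%:E <= A%:E)%E].

Lemma mean_leD f g A B : mean_le f A -> mean_le g B ->
  mean_le (fun x => f x + g x) (A + B).
Proof.
move=> [mf f0 fA] [mg g0 gB]; split; [exact: measurable_funD|by move=> x; rewrite addr_ge0|].
by rewrite ge0_integral_EFinD// EFinD; exact: leeD.
Qed.

Lemma mean_leZ f A k : 0 <= k -> mean_le f A -> mean_le (fun x => k * f x) (k * A).
Proof.
move=> k0 [mf f0 fA]; split; [exact: measurable_funM|by move=> x; rewrite mulr_ge0|].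
by rewrite ge0_integral_EFinZl// EFinM; exact: lee_wpmul2l.
Qed.

Lemma mean_le_cst c : 0 <= c -> mean_le (cst c) c.
Proof.
move=> c0; split => //.
by rewrite (probability_integral_cst P).
Qed.

Lemma mean_le_indic (D : set T) A : measurable D -> (P D <= A%:E)%E -> mean_le \1_D A.
Proof.
move=> mD DA; split; first exact: measurable_indic.
  by move=> x; rewrite indicE.
by rewrite integral_indic// setIT.
Qed.

Lemma mean_le_sum n (f : 'I_n -> T -> R) A : (forall i, mean_le (f i) A) ->
  mean_le (fun x => \sum_(i < n) f i x) (n%:R * A).
Proof.
move=> h; elim: n f h => [|n ih] f h.
  rewrite (_ : (fun x => _) = cst 0); last by apply/funext => x; rewrite big_ord0.
  by rewrite mul0r; exact: mean_le_cst.
rewrite (_ : (fun x => _) = (fun x => f ord0 x + \sum_(i < n) f (lift ord0 i) x)); last first.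
  by apply/funext => x; rewrite big_ord_recl.
rewrite -natr1 mulrDl mul1r addrC; apply: mean_leD => //.
by apply: ih.
Qed.

Lemma mean_le_dom f g A : measurable_fun setT f -> (forall x, 0 <= f x <= g x) ->
  mean_le g A -> mean_le f A.
Proof.
move=> mf fg [mg g0 gA]; split => // [x|]; first by case/andP: (fg x).
apply: le_trans gA; apply: ge0_le_integral_EFin => // x; by case/andP: (fg x).
Qed.

Lemma mean_leW f A B : A <= B -> mean_le f A -> mean_le f B.
Proof. by move=> AB [mf f0 fA]; split => //; apply: le_trans fA _; rewrite lee_fin. Qed.

Lemma mean_le_ge0 f A : mean_le f A -> 0 <= A.
Proof.
move=> [mf f0 fA]; rewrite -lee_fin; apply: le_trans fA.
by apply: integral_ge0 => x _; rewrite lee_fin.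
Qed.

Lemma variance_le_mean_sqr f A : measurable_fun setT f ->
  mean_le (fun x => f x ^+ 2) A -> ('V_P[f] <= A%:E)%E.
Proof.
move=> mf [_ _ fA].
have L2 : f \in Lfun P 2%:E.
  apply/andP; split; first by rewrite inE.
  rewrite inE /= /finite_norm unlock /=.
  apply: poweR_lty; apply: le_lt_trans (ltry A).
  apply: le_trans fA; rewrite le_eqVlt; apply/orP; left; apply/eqP.
  apply: eq_integral => x _ /=.
  by rewrite ?poweR_EFin (@powR_mulrn _ _ 2)// real_normK// num_real.
rewrite varianceE//; apply: le_trans fA.
have -> : (\int[P]_x (f x ^+ 2)%:E = 'E_P[f ^+ 2])%E by rewrite unlock.
have : ('E_P[f] \is a fin_num)%E by apply: expectation_fin_num; rewrite Lfun_subset12 ?fin_num_measure.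
case: ('E_P[f])%E => // r _.
rewrite -EFin_expe; set E2 := ('E_P[_])%E; case: E2 => [s| |] //=.
by rewrite -EFinD lee_fin gerBl// sqr_ge0.
Qed.

End mean_bounds.

Section moments.
Context (R : realType) (d : measure_display) (Omega : measurableType d)
  (P : probability Omega R) (F : R -> set (set Omega)).
Hypothesis nF : normal_filtration P F.

Let FP t : 0 <= t -> sigma_algebra setT (F t) /\ F t `<=` measurable.
Proof.
by move=> t0; split; [exact: (filtration_sigma_algebra nF)|exact: (filtration_measurable nF)].
Qed.

Lemma adapted_measurable m (I : set R) (Z : R -> Omega -> 'rV[R]_m) t :
  adapted_on F I Z -> 0 <= t -> I t ->
  measurable_fun setT (Z t : Omega -> borelV R m).
Proof.
move=> aZ t0 It; apply: (sub_measurable_measurable FP t0).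
exact: (adapted_sub_measurable aZ It).
Qed.

Lemma count_succ_ltn n : (0 < n)%N -> (1 + \sum_(i < n) (i.+1 < n))%N = n.
Proof.
case: n => // n _; rewrite big_ord_recr/= ltnn addn0.
rewrite (eq_bigr (fun=> 1%N)) => [|i _]; last by rewrite ltnS ltn_ord.
by rewrite sum_nat_const card_ord muln1 add1n.
Qed.

(** T / E N <= T because N >= 1. Measurability of N is first recovered from that of the grid times:
    N is one plus the number of n with t_(n+1) < T. *)
Lemma average_step_le (T : R) (N : Omega -> nat) (tg : nat -> Omega -> R) :
  0 < T -> time_grid P F T N tg -> 0 <= average_step P T N <= T.
Proof.
move=> T0 [gae gst EN].
have mtg n : measurable_fun setT (tg n.+1).
  by move=> _ B mB; rewrite setTI; exact: (gst n B mB).1.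
pose f (k : nat) (w : Omega) : R := 1 + \sum_(n < k) \1_(`]-oo, T[%classic) (tg n.+1 w).
have mf k : measurable_fun setT (f k).
  apply: measurable_funD => //; apply: measurable_sum => n.
  by apply: (measurableT_comp _ (mtg n)); exact: measurable_indic.
have cf : {ae P, forall w, f ^~ w @ \oo --> ((N w)%:R : R)}.
  apply: filterS gae => w [N0 t0 tS tN].
  apply: cvg_near_cst; exists (N w) => // k /= Nk.
  rewrite /f.
  have ind n : \1_(`]-oo, T[%classic) (tg n.+1 w) = (n.+1 < N w)%N%:R :> R.
    rewrite indicE mem_setE in_itv/=; congr (_%:R); congr nat_of_bool.
    have [nN|Nn] := ltnP n.+1 (N w); last by rewrite tN// ltxx.
    apply: (lt_le_trans (tS _ nN)).
    exact: (@grid_le _ _ (tg ^~ w) _ tS tN n.+2).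
  under eq_bigr do rewrite ind.
  rewrite -natr_sum -(natrD _ 1); congr (_%:R).
  rewrite -(subnKC Nk) big_split_ord/= [X in (_ + (_ + X))%N]big1 ?addn0; last first.
    by move=> i _; rewrite ltnNge leqW// leq_addr.
  exact: count_succ_ltn.
have mN := ae_cvg_measurable (normal_filtration_complete nF) mf cf.
have E1 : (1 <= 'E_P[fun w => (N w)%:R])%E.
  rewrite unlock -(probability_integral_cst P 1).
  apply: ae_ge0_le_integral_EFin => //.
  by apply: filterS gae => w [N0 _ _ _]; rewrite ler1n.
rewrite /average_step; move: E1 EN; case: ('E_P[fun w => (N w)%:R])%E => [e| |]//.
rewrite lee_fin => e1 _ /=.
have e0 : 0 < e by exact: lt_le_trans e1.
apply/andP; split; first by rewrite divr_ge0// ltW.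
by rewrite ler_pdivrMr// ler_peMr// ltW.
Qed.

Lemma numerical_moment m (h : R -> R) (Zh : R -> R -> Omega -> 'rV[R]_m)
    (Z : R -> Omega -> 'rV[R]_m) (n : nat) : (0 < n)%N ->
  numerical_solution_assumption P h Zh Z ->
  (forall T, 0 < T -> adapted_on F `[0, T] (Zh T)) ->
  exists C : R, forall T, 0 < T -> (sup_moment P n%:R T (Zh T) <= C%:E)%E /\
    forall t, 0 <= t -> t <= T -> mean_le P (fun w => enorm (Zh T t w) ^+ n) C.
Proof.
move=> n0 hZ aZ; have [] := hZ n%:R _; first by rewrite ler1n.
move=> C [c h1]; exists C => T T0; have [hC _] := h1 T T0; split => // t t0 tT.
split.
- apply: measurable_funX; apply: (measurableT_comp (@measurable_enorm R m)).
  by apply: (adapted_measurable (aZ T T0)) => //=; rewrite in_itv/= t0.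
- by move=> w; rewrite exprn_ge0// enorm_ge0.
by apply: (sup_moment_le hC); rewrite t0.
Qed.

Lemma numerical_error m (h : R -> R) (Zh : R -> R -> Omega -> 'rV[R]_m)
    (Z : R -> Omega -> 'rV[R]_m) (n : nat) : (0 < n)%N ->
  numerical_solution_assumption P h Zh Z ->
  (forall T, 0 < T -> adapted_on F `[0, T] (Zh T)) -> adapted_on F `[0, +oo[ Z ->
  (forall T, 0 < T -> 0 <= h T <= T) ->
  exists c : R, forall T, 0 < T ->
    mean_le P (fun w => enorm (Zh T T w - Z T w) ^+ n) (c * T ^+ n).
Proof.
move=> n0 hZ aZh aZ hh; have [] := hZ n%:R _; first by rewrite ler1n.
(* The sign of c is not given, and replacing the step h by its upper bound T needs a nonnegative
   factor. *)
move=> C [c h1]; exists `|c| => T T0; have [_ hc] := h1 T T0.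
have TT : 0 <= T <= T by rewrite ltW/=.
have mc (i : 'I_m) : measurable_fun setT (fun w => (Zh T T w - Z T w) 0 i).
  rewrite (_ : (fun w => _) = (fun w => Zh T T w 0 i - Z T w 0 i)); last first.
    by apply/funext => w; rewrite !mxE.
  apply: measurable_funB; apply: (measurableT_comp (@measurable_coord R m i)).
    by apply: (adapted_measurable (aZh T T0)) => //=; exact: ltW.
  by apply: (adapted_measurable aZ) => //=; rewrite ?in_itv/= ltW.
split.
- apply: measurable_funX.
  have ms : measurable_fun setT (@Num.sqrt R).
    by apply: continuous_measurable_fun; exact: sqrt_continuous.
  apply: (measurableT_comp ms); apply: measurable_sum => i.
  exact: measurable_funM.
- by move=> w; rewrite exprn_ge0// enorm_ge0.
apply: (le_trans (sup_moment_le (Z := fun t w => Zh T t w - Z t w) (C := c * h T `^ n%:R) hc TT)).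
have /andP[h0 hT] := hh T T0.
rewrite lee_fin powR_mulrn//.
apply: (@le_trans _ _ (`|c| * h T ^+ n)).
  by rewrite ler_wpM2r ?exprn_ge0// ler_norm.
by rewrite ler_wpM2l// lerXn2r// nnegrE ltW.
Qed.

Lemma poly_growth_moment m (h : R -> R) (Zh : R -> R -> Omega -> 'rV[R]_m)
    (Z : R -> Omega -> 'rV[R]_m) (g : 'rV[R]_m -> R) (n : nat) :
  numerical_solution_assumption P h Zh Z ->
  (forall T, 0 < T -> adapted_on F `[0, T] (Zh T)) ->
  measurable_fun setT (g : borelV R m -> R) -> poly_growth g ->
  exists C : R, forall T, 0 < T -> mean_le P (fun w => `|g (Zh T T w)| ^+ n) C.
Proof.
move=> hZ aZ mg [K [q hg]].
(* The exponent q n + 1, rather than q n, keeps the moment order at least 1 when q n = 0. *)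
have [C hC] := numerical_moment (ltn0Sn (q * n)) hZ aZ.
exists (`|K| ^+ n * (2 ^+ n * (2 + C))) => T T0.
have [_ /(_ T (ltW T0) (lexx _)) hT] := hC T T0.
have mZ : measurable_fun setT (Zh T T : Omega -> borelV R m).
  by apply: (adapted_measurable (aZ T T0)) => //=; rewrite ?in_itv/= ltW/=.
apply: (@mean_le_dom _ _ _ _ _
    (fun w => `|K| ^+ n * (2 ^+ n * (2 + enorm (Zh T T w) ^+ (q * n).+1)))).
- apply: measurable_funX; apply: measurableT_comp => //.
  exact: (measurableT_comp mg mZ).
- move=> w; rewrite exprn_ge0//=.
  set e := enorm _; have e0 : 0 <= e by exact: enorm_ge0.
  apply: (@le_trans _ _ ((`|K| * (1 + e ^+ q)) ^+ n)).
    rewrite lerXn2r ?nnegrE// ?mulr_ge0 ?addr_ge0 ?exprn_ge0//.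
    by apply: (le_trans (hg _)); rewrite ler_wpM2r ?addr_ge0 ?exprn_ge0// ler_norm.
  rewrite exprMn ler_wpM2l ?exprn_ge0//.
  have [e1|e1] := leP e 1.
    apply: (@le_trans _ _ (2 ^+ n)).
      rewrite lerXn2r ?nnegrE ?addr_ge0 ?exprn_ge0//.
      by rewrite -[leRHS]/(1 + 1) lerD2l exprn_ile1.
    have E0 : 0 <= e ^+ (q * n).+1 by exact: exprn_ge0.
    by rewrite ler_peMr ?exprn_ge0//; lra.
  have q1 : 1 <= e ^+ q by rewrite exprn_ege1// ltW.
  apply: (@le_trans _ _ ((2 * e ^+ q) ^+ n)).
    rewrite lerXn2r ?nnegrE ?addr_ge0 ?mulr_ge0 ?exprn_ge0//; lra.
  rewrite exprMn ler_wpM2l ?exprn_ge0// -exprM exprS.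
  have E0 : 0 <= e ^+ (q * n) by exact: exprn_ge0.
  have : 0 <= (e - 1) * e ^+ (q * n) by rewrite mulr_ge0// subr_ge0 ltW.
  lra.
apply: mean_leZ; first by rewrite exprn_ge0.
apply: mean_leZ; first by rewrite exprn_ge0.
by apply: mean_leD => //; exact: mean_le_cst.
Qed.

(** If |y_T| > L T, then W leaves the ball before T, so the outcome lies in all but finitely many of
    the exit sets, each of probability O(T^2). *)
Lemma variation_small_time_prob m (W : R -> Omega -> 'rV[R]_m) (sigma S : R)
    (f : R -> 'rV[R]_m -> 'rV[R]_m) (xi0 : 'rV[R]_m) (Y y : R -> Omega -> 'rV[R]_m) :
  brownian_motion P F W -> 0 < sigma -> 0 < S -> regular_drift f ->
  strong_solution P F W sigma (f 0) xi0 Y -> modified_variation P F f S Y y ->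
  exists L C T0 : R, [/\ 0 < L, 0 < T0, T0 <= 1 &
    forall T, 0 < T -> T <= T0 ->
      mean_le P \1_[set w | L * T < `|y T w|] (C * T ^+ 2)].
Proof.
move=> bW sig0 S0 rf [aY cY eY] [ay cy ey].
have [a [L [T0 [a0 L0 T00 T01 H]]]] := variation_small_time xi0 rf sig0 S0.
exists L, (m%:R * (50 * 50) / a ^+ 4), T0; split => // T Tp TT0.
have [A [mA PA hA]] := brownian_exit_sets nF bW Tp a0.
have my : measurable_fun setT (fun w => `|y T w|).
  apply: (measurableT_comp (f := fun v : borelV R m => `|v : 'rV[R]_m|)).
    by apply: continuous_measurable_borelV; exact: norm_continuous.
  by apply: (adapted_measurable ay) => //=; rewrite ?in_itv/= ltW.
have mS : measurable [set w | L * T < `|y T w|].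
  rewrite (_ : [set _ | _] = (fun w => `|y T w|) @^-1` `]L * T, +oo[).
    by rewrite -[X in measurable X]setTI; exact: my.
  by apply/seteqP; split => w /=; rewrite in_itv/= andbT.
apply: mean_le_indic => //.
apply: (ae_liminf_probability_le (normal_filtration_complete nF) mS mA).
  by move=> J; apply: (le_trans (PA J)); rewrite lee_fin; lra.
have cW : {ae P, forall w, {within `[0, +oo[, continuous (fun t => W t w)}}.
  by case: bW.
have g1 := ae_and (ae_and cY eY) (ae_and cy ey).
apply: filterS (ae_and g1 (ae_and cW hA)) => w [[[cYw eYw] [cyw eyw]] [cWw hAw]] /= Lw.
apply: contrapT => nA.
have {}hJ : forall J0 : nat, exists2 J : nat, (J0 <= J)%N & ~ A J w.
  move=> J0; apply: contrapT => hJ; apply: nA; exists J0 => // J /= JJ.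
  by apply: contrapT => nAJ; apply: hJ; exists J.
have hw i t : 0 <= t -> t <= T -> `|W t w 0 i| <= a.
  apply: (@brownian_sup_le _ _ _ _ W T a w Tp) => [j|J0].
    exact: within_continuous_coord.
  by have [J JJ nAJ] := hJ J0; exists J => //; exact: hAw.
have := H T (fun t => W t w) (fun t => Y t w) (fun t => y t w) Tp TT0 cYw cyw eYw eyw hw.
by rewrite leNgt Lw.
Qed.

End moments.

(** Taken with t = T, it pairs a factor with bounded second moment with one of second moment O(T^2),
    and both terms become O(T). *)
Lemma weighted_amgm (R : realFieldType) (t x y : R) : 0 < t ->
  x * y <= t * x ^+ 2 + t^-1 * y ^+ 2.
Proof.
move=> t0; have ti : 0 < t^-1 by rewrite invr_gt0.
have E : t * (x - t^-1 * y) ^+ 2 = t * x ^+ 2 - 2 * (x * y) + t^-1 * y ^+ 2.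
  by field; exact: lt0r_neq0.
have h1 : 0 <= t * (x - t^-1 * y) ^+ 2 by rewrite mulr_ge0 ?sqr_ge0// ltW.
have h2 : 0 <= t * x ^+ 2 by rewrite mulr_ge0 ?sqr_ge0// ltW.
have h3 : 0 <= t^-1 * y ^+ 2 by rewrite mulr_ge0 ?sqr_ge0// ltW.
lra.
Qed.

(** To be read with G = |grad phi(Yh_T)|, u = |yh_T|, v = |yh_T - y_T|, z = |y_T|^2 and b the
    indicator of |y_T| > L T. Off that event z = O(T^2); on it T^-1 b pays for T (G^2 z)^2, since b
    has mean O(T^2). Moments of y are drawn from those of [yh] and of the error: z <= 2 u^2 + 2 v^2
    gives z^4 <= 128 (u^8 + v^8). *)
Lemma small_time_inequality (R : realType) (G u v z b c T : R) :
  0 < T -> T <= 1 -> 0 <= z -> 0 <= c -> 0 <= b ->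
  u ^+ 2 <= 2 * v ^+ 2 + 2 * z -> z <= 2 * u ^+ 2 + 2 * v ^+ 2 ->
  (b < 1 -> z <= c * T ^+ 2) ->
  G ^+ 2 * u ^+ 2 <= 2 * (T * G ^+ 4 + T^-1 * v ^+ 4) +
    2 * (c * T * (1 + G ^+ 4) + (T * (G ^+ 8 + 128 * (u ^+ 8 + v ^+ 8)) + T^-1 * b)).
Proof.
move=> T0 T1 z0 c0 b0 uvz zuv hb.
have G20 : 0 <= G ^+ 2 by exact: sqr_ge0.
have G4 : G ^+ 4 = (G ^+ 2) ^+ 2 by rewrite -exprM.
have v4 : v ^+ 4 = (v ^+ 2) ^+ 2 by rewrite -exprM.
have h1 : G ^+ 2 * v ^+ 2 <= T * G ^+ 4 + T^-1 * v ^+ 4.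
  by rewrite G4 v4; exact: weighted_amgm.
have ev8 (x : R) : x ^+ 8 = ((x ^+ 2) ^+ 2) ^+ 2 by rewrite -!exprM.
have z4 : (z ^+ 2) ^+ 2 <= 128 * (u ^+ 8 + v ^+ 8).
  have u2 := sqr_ge0 u; have v2 := sqr_ge0 v.
  have s1 : z ^+ 2 <= 8 * ((u ^+ 2) ^+ 2 + (v ^+ 2) ^+ 2).
    apply: (@le_trans _ _ ((2 * u ^+ 2 + 2 * v ^+ 2) ^+ 2)).
      by rewrite lerXn2r// nnegrE addr_ge0// mulr_ge0.
    have := sqr_ge0 (u ^+ 2 - v ^+ 2).
    rewrite !sqrrD sqrrN; lra.
  apply: (@le_trans _ _ ((8 * ((u ^+ 2) ^+ 2 + (v ^+ 2) ^+ 2)) ^+ 2)).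
    by rewrite lerXn2r// nnegrE ?sqr_ge0// mulr_ge0// addr_ge0// sqr_ge0.
  rewrite exprMn !ev8; set p := (u ^+ 2) ^+ 2; set q := (v ^+ 2) ^+ 2.
  have := sqr_ge0 (p - q); rewrite !sqrrD sqrrN; lra.
have P8 : 0 <= 128 * (u ^+ 8 + v ^+ 8).
  by apply: le_trans z4; exact: sqr_ge0.
have G40 : 0 <= G ^+ 4 by exact: exprn_even_ge0.
have G80 : 0 <= G ^+ 8 by exact: exprn_even_ge0.
have Ti : 0 < T^-1 by rewrite invr_gt0.
have h2 : G ^+ 2 * z <= c * T * (1 + G ^+ 4) +
   (T * (G ^+ 8 + 128 * (u ^+ 8 + v ^+ 8)) + T^-1 * b).
  have p1 : 0 <= c * T * (1 + G ^+ 4) by rewrite !mulr_ge0 ?addr_ge0// ltW.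
  have p2 : 0 <= T * (G ^+ 8 + 128 * (u ^+ 8 + v ^+ 8)) by rewrite mulr_ge0 ?addr_ge0// ltW.
  have p3 : 0 <= T^-1 * b by rewrite mulr_ge0// ltW.
  have [b1|b1] := ltP b 1.
    have zT : z <= c * T.
      apply: (le_trans (hb b1)); rewrite ler_wpM2l// expr2 ler_piMr// ltW//.
    have G2 : G ^+ 2 <= 1 + G ^+ 4.
      have := sqr_ge0 (G ^+ 2 - 1); rewrite sqrrB -G4 mulr1 expr1n; lra.
    have : G ^+ 2 * z <= (1 + G ^+ 4) * (c * T) by rewrite ler_pM.
    rewrite [_ * (c * T)]mulrC; lra.
  have a1 : (G ^+ 2 * z) * 1 <= T * (G ^+ 2 * z) ^+ 2 + T^-1 * 1 ^+ 2 by exact: weighted_amgm.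
  have a2 : (G ^+ 2 * z) ^+ 2 <= G ^+ 8 + 128 * (u ^+ 8 + v ^+ 8).
    rewrite exprMn; have := weighted_amgm ((G ^+ 2) ^+ 2) (z ^+ 2) (@ltr01 R).
    rewrite invr1 !mul1r -ev8; lra.
  have a3 : T * (G ^+ 2 * z) ^+ 2 <= T * (G ^+ 8 + 128 * (u ^+ 8 + v ^+ 8)).
    by rewrite ler_wpM2l// ltW.
  have a4 : T^-1 * 1 <= T^-1 * b by rewrite ler_wpM2l// ltW.
  move: a1; rewrite mulr1 expr1n; lra.
have : G ^+ 2 * u ^+ 2 <= G ^+ 2 * (2 * v ^+ 2 + 2 * z) by rewrite ler_wpM2l.
rewrite mulrDr !(mulrCA (G ^+ 2)); lra.
Qed.

Lemma sqr_enormB_le (R : realType) m (u y : 'rV[R]_m) :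
  enorm u ^+ 2 <= 2 * enorm (u - y) ^+ 2 + 2 * enorm y ^+ 2.
Proof.
rewrite !sqr_enorm !mulr_sumr -big_split/=; apply: ler_sum => i _; rewrite !mxE.
have := sqr_ge0 ((u 0 i - y 0 i) - y 0 i); rewrite !sqrrB; lra.
Qed.

Lemma sqr_enorm_le_sub (R : realType) m (u y : 'rV[R]_m) :
  enorm y ^+ 2 <= 2 * enorm u ^+ 2 + 2 * enorm (u - y) ^+ 2.
Proof.
rewrite !sqr_enorm !mulr_sumr -big_split/=; apply: ler_sum => i _; rewrite !mxE.
have := sqr_ge0 (u 0 i + (u 0 i - y 0 i)); rewrite sqrrD !sqrrB; lra.
Qed.

Lemma sqr_enorm_le_normr (R : realType) m (y : 'rV[R]_m) (c : R) : `|y| <= c ->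
  enorm y ^+ 2 <= m%:R * c ^+ 2.
Proof.
move=> yc; rewrite sqr_enorm; apply: (@le_trans _ _ (\sum_(i < m) c ^+ 2)).
  apply: ler_sum => i _; have yi := le_trans (normr_coord_le y i) yc.
  by rewrite -real_normK ?num_real// lerXn2r// nnegrE// (le_trans _ yi).
by rewrite sumr_const card_ord mulr_natl.
Qed.

Lemma measurable_enorm_gradient (R : realType) m (phi : 'rV[R]_m -> R) :
  (forall x, differentiable phi x) ->
  measurable_fun setT ((fun x => enorm (gradient phi x)) : borelV R m -> R).
Proof.
move=> dphi; have ms : measurable_fun setT (@Num.sqrt R).
  by apply: continuous_measurable_fun; exact: sqrt_continuous.
apply: (measurableT_comp ms); apply: measurable_sum => i.
rewrite (_ : (fun x => _) = (fun x : borelV R m => 'D_(delta_mx 0 i) phi (x : 'rV[R]_m) *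
   'D_(delta_mx 0 i) phi (x : 'rV[R]_m))).
  by apply: measurable_funM; exact: measurable_directional_derivative.
by apply/funext => x; rewrite !mxE.
Qed.

Lemma weighted_increment_sum (R : realType) m (c : R) n (z x : nat -> 'rV[R]_m) :
  \sum_(k < n) c * inner (z k) (x k.+1 - x k) =
  c * \sum_(i < m) \sum_(k < n) z k 0 i * (x k.+1 0 i - x k 0 i).
Proof.
rewrite exchange_big/= mulr_sumr; apply: eq_bigr => k _; congr (_ * _).
by apply: eq_bigr => i _; rewrite !mxE.
Qed.

Section estimator.
Context (R : realType) (m : nat) (d : measure_display)
    (Omega : measurableType d) (P : probability Omega R)
    (F : R -> set (set Omega)) (W : R -> Omega -> 'rV[R]_m)
    (sigma : R) (f : R -> 'rV[R]_m -> 'rV[R]_m) (xi0 : 'rV[R]_m)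
    (phi : 'rV[R]_m -> R) (S : R) (Y y : R -> Omega -> 'rV[R]_m)
    (N : R -> Omega -> nat) (tg : R -> nat -> Omega -> R)
    (Yh yh : R -> R -> Omega -> 'rV[R]_m).
Hypotheses (nF : normal_filtration P F) (bW : brownian_motion P F W).
Hypotheses (sig0 : 0 < sigma) (S0 : 0 < S).
Hypothesis gT : forall T, 0 < T -> time_grid P F T (N T) (tg T).
Hypothesis nYh : forall T, 0 < T -> numerical_approximation P F T (tg T) xi0 (Yh T).
Hypothesis nyh : forall T, 0 < T -> numerical_approximation P F T (tg T) 0 (yh T).
Hypothesis hYh : numerical_solution_assumption P (fun T => average_step P T (N T)) Yh Y.
Hypothesis hyh : numerical_solution_assumption P (fun T => average_step P T (N T)) yh y.

Let aYh T : 0 < T -> adapted_on F `[0, T] (Yh T).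
Proof. by case/nYh. Qed.

Let ayh T : 0 < T -> adapted_on F `[0, T] (yh T).
Proof. by case/nyh. Qed.

Definition martingale_term T w :=
  phi (Yh T T w) * \sum_(n < N T w) S / sigma *
    inner (yh T (tg T n w) w) (W (tg T n.+1 w) w - W (tg T n w) w).

Lemma martingale_term_mean : (forall x, differentiable phi x) -> poly_growth phi ->
  random_grid_moments P N tg yh ->
  exists K, forall T, 0 < T -> measurable_fun setT (martingale_term T) /\
    mean_le P (fun w => martingale_term T w ^+ 2) (T * K).
Proof.
move=> dphi gphi rg.
have mphi : measurable_fun setT (phi : borelV R m -> R).
  by apply: continuous_measurable_borelV => x; exact: differentiable_continuous.
have [Cphi hphi] := poly_growth_moment nF 4 hYh aYh mphi gphi.
have [C4 h4] := numerical_moment nF (isT : (0 < 4)%N) hyh ayh.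
have [Cr hr] := rg 4%:R (ltac:(by rewrite ler1n)).
pose C := Num.max C4 Cr.
(* The factor m^3 is the price of expanding the fourth power of a sum over m coordinates, each
   contributing 2500 T^2 C. *)
pose K4 := (S / sigma) ^+ 4 * (m%:R ^+ 3 * (m%:R * (50 * 50 * C))).
exists (Cphi + K4) => T T0.
have CL s : 0 <= s -> s < T ->
    (\int[P]_w (enorm (yh T (last_grid_time (N T) (tg T) s w) w) ^+ 4)%:E <= C%:E)%E.
  apply: (last_grid_moment nF (gT T0) (nyh T0)).
    by apply: (le_trans (h4 T T0).1); rewrite lee_fin le_max lexx.
  by move=> nr; apply: (le_trans (hr T T0 nr)); rewrite lee_fin le_max lexx orbT.
pose I i w := \sum_(n < N T w) yh T (tg T n w) w 0 i *
  (W (tg T n.+1 w) w 0 i - W (tg T n w) w 0 i).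
have hI i : measurable_fun setT (I i) /\
    mean_le P (fun w => I i w ^+ 4) (50 * 50 * T ^+ 2 * C).
  have [mI eI] := stochastic_sum_exp4_le nF bW i T0 (gT T0) (nyh T0) CL.
  by split => //; split => // [|w]; [exact: measurable_funX|exact: exprn_even_ge0].
pose Z w := S / sigma * \sum_(i < m) I i w.
have tE : martingale_term T = fun w => phi (Yh T T w) * Z w.
  apply/funext => w; rewrite /martingale_term /Z /I.
  by rewrite (weighted_increment_sum _ _ (fun n => yh T (tg T n w) w) (fun n => W (tg T n w) w)).
have mZ : measurable_fun setT Z.
  apply: measurable_funM => //; apply: measurable_sum => i; exact: (hI i).1.
have mphiY : measurable_fun setT (fun w => phi (Yh T T w)).
  apply: (measurableT_comp mphi).
  by apply: (adapted_measurable nF (aYh T0)) => //=; rewrite ?in_itv/= ltW/=.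
have mt : measurable_fun setT (martingale_term T) by rewrite tE; exact: measurable_funM.
have sS0 : 0 <= (S / sigma) ^+ 4 by exact: exprn_even_ge0.
have Z4 : mean_le P (fun w => Z w ^+ 4) (T ^+ 2 * K4).
  apply: (@mean_leW _ _ _ _ _
    ((S / sigma) ^+ 4 * (m%:R ^+ 3 * (m%:R * (50 * 50 * T ^+ 2 * C))))); first by rewrite /K4; lra.
  apply: (@mean_le_dom _ _ _ _ _
    (fun w => (S / sigma) ^+ 4 * (m%:R ^+ 3 * (\sum_(i < m) I i w ^+ 4)))).
  - exact: measurable_funX.
  - move=> w; rewrite exprn_even_ge0//= exprMn ler_wpM2l//; exact: exp4_sum_le.
  - apply: mean_leZ => //; apply: mean_leZ; first exact: exprn_ge0.
    by apply: mean_le_sum => i; exact: (hI i).2.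
split => //.
have Ti : 0 < T^-1 by rewrite invr_gt0.
apply: (@mean_leW _ _ _ _ _ (T * Cphi + T^-1 * (T ^+ 2 * K4))).
  have -> : T^-1 * (T ^+ 2 * K4) = T * K4 by field; exact: lt0r_neq0.
  by rewrite mulrDr.
apply: (@mean_le_dom _ _ _ _ _ (fun w => T * `|phi (Yh T T w)| ^+ 4 + T^-1 * Z w ^+ 4)).
- exact: measurable_funX.
- move=> w; rewrite sqr_ge0/= tE exprMn.
  have e4 (x : R) : x ^+ 4 = (x ^+ 2) ^+ 2 by rewrite -exprM.
  rewrite !e4 real_normK ?num_real//; exact: weighted_amgm.
- apply: mean_leD; apply: mean_leZ => //; try exact: ltW.
  exact: hphi.
Qed.

Lemma gradient_term_mean : (forall x, differentiable phi x) ->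
  poly_growth (fun x => enorm (gradient phi x)) -> regular_drift f ->
  strong_solution P F W sigma (f 0) xi0 Y -> modified_variation P F f S Y y ->
  exists K, forall T, 0 < T ->
    mean_le P (fun w => enorm (gradient phi (Yh T T w)) ^+ 2 * enorm (yh T T w) ^+ 2) (T * K).
Proof.
move=> dphi gg rf sY vy.
have mg := measurable_enorm_gradient dphi.
have [G4 hG4] := poly_growth_moment nF 4 hYh aYh mg gg.
have [G8 hG8] := poly_growth_moment nF 8 hYh aYh mg gg.
have ay : adapted_on F `[0, +oo[ y by case: vy.
have hstep T : 0 < T -> 0 <= average_step P T (N T) <= T.
  by move=> T0; exact: (average_step_le nF T0 (gT T0)).
have [C4 h4] := numerical_moment nF (isT : (0 < 4)%N) hyh ayh.
have [C8 h8] := numerical_moment nF (isT : (0 < 8)%N) hyh ayh.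
have [c4 e4] := numerical_error nF (isT : (0 < 4)%N) hyh ayh ay hstep.
have [c8 e8] := numerical_error nF (isT : (0 < 8)%N) hyh ayh ay hstep.
have [L [C [T0 [L0 T00 T01 hp]]]] := variation_small_time_prob nF bW sig0 S0 rf sY vy.
pose c := m%:R * L ^+ 2.
have c0 : 0 <= c by rewrite mulr_ge0// sqr_ge0.
pose K1 := T0^-1 * (G4 + C4).
pose K2 := 2 * (G4 + c4) + 2 * (c * (1 + G4) + ((G8 + 128 * (C8 + c8)) + C)).
exists (Num.max K1 K2) => T Tp.
have mgY : measurable_fun setT (fun w => enorm (gradient phi (Yh T T w))).
  apply: (measurableT_comp mg).
  by apply: (adapted_measurable nF (aYh Tp)) => //=; rewrite ?in_itv/= ltW/=.
have myh : measurable_fun setT (fun w => enorm (yh T T w)).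
  apply: (measurableT_comp (@measurable_enorm R m)).
  by apply: (adapted_measurable nF (ayh Tp)) => //=; rewrite ?in_itv/= ltW/=.
have mm : measurable_fun setT
    (fun w => enorm (gradient phi (Yh T T w)) ^+ 2 * enorm (yh T T w) ^+ 2).
  by apply: measurable_funM; exact: measurable_funX.
have mm0 w : 0 <= enorm (gradient phi (Yh T T w)) ^+ 2 * enorm (yh T T w) ^+ 2.
  by rewrite mulr_ge0// sqr_ge0.
have hG4T : mean_le P (fun w => enorm (gradient phi (Yh T T w)) ^+ 4) G4.
  have := hG4 T Tp; congr (mean_le P _ _); apply/funext => w.
  by rewrite ger0_norm// enorm_ge0.
have hG8T : mean_le P (fun w => enorm (gradient phi (Yh T T w)) ^+ 8) G8.
  have := hG8 T Tp; congr (mean_le P _ _); apply/funext => w.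
  by rewrite ger0_norm// enorm_ge0.
have h4T := (h4 T Tp).2 T (ltW Tp) (lexx _).
have h8T := (h8 T Tp).2 T (ltW Tp) (lexx _).
have Tp0 := ltW Tp; have G40 := mean_le_ge0 hG4T; have C40 := mean_le_ge0 h4T.
(* For T > T0 a bound independent of T suffices, because 1 <= T / T0; this is the origin of [K1]. *)
have [TT0|T0T] := leP T T0; last first.
  apply: (@mean_leW _ _ _ _ _ (G4 + C4)).
    apply: (@le_trans _ _ (T * K1)); last by rewrite ler_wpM2l// le_max lexx.
    by rewrite /K1 mulrA ler_peMl ?addr_ge0// ler_pdivlMr// mul1r ltW.
  apply: mean_le_dom (mean_leD hG4T h4T) => // w; rewrite mm0/=.
  have := weighted_amgm (enorm (gradient phi (Yh T T w)) ^+ 2) (enorm (yh T T w) ^+ 2) (@ltr01 R).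
  by rewrite invr1 !mul1r -!exprM.
have T1 : T <= 1 by exact: le_trans TT0 T01.
have Ti : 0 < T^-1 by rewrite invr_gt0.
have Ti0 := ltW Ti.
have e4T := e4 T Tp; have e8T := e8 T Tp; have hpT := hp T Tp TT0.
have G80 := mean_le_ge0 hG8T; have C80 := mean_le_ge0 h8T.
have c40 : 0 <= c4.
  by have := mean_le_ge0 e4T; rewrite pmulr_lge0// exprn_gt0.
have c80 : 0 <= c8.
  by have := mean_le_ge0 e8T; rewrite pmulr_lge0// exprn_gt0.
pose B := [set w | L * T < `|y T w|].
have big : mean_le P (fun w =>
   2 * (T * enorm (gradient phi (Yh T T w)) ^+ 4 + T^-1 * enorm (yh T T w - y T w) ^+ 4) +
    2 * (c * T * (1 + enorm (gradient phi (Yh T T w)) ^+ 4) +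
     (T * (enorm (gradient phi (Yh T T w)) ^+ 8 +
       128 * (enorm (yh T T w) ^+ 8 + enorm (yh T T w - y T w) ^+ 8)) + T^-1 * \1_B w)))
   (2 * (T * G4 + T^-1 * (c4 * T ^+ 4)) +
    2 * (c * T * (1 + G4) + (T * (G8 + 128 * (C8 + c8 * T ^+ 8)) + T^-1 * (C * T ^+ 2)))).
  have cT0 : 0 <= c * T by rewrite mulr_ge0.
  apply: mean_leD; apply: mean_leZ => //; apply: mean_leD.
  - exact: mean_leZ.
  - exact: mean_leZ.
  - by apply: mean_leZ => //; apply: mean_leD => //; exact: mean_le_cst.
  apply: mean_leD; apply: mean_leZ => //.
  by apply: mean_leD => //; apply: mean_leZ => //; exact: mean_leD.
apply: (@mean_leW _ _ _ _ _ (2 * (T * G4 + T^-1 * (c4 * T ^+ 4)) +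
    2 * (c * T * (1 + G4) + (T * (G8 + 128 * (C8 + c8 * T ^+ 8)) + T^-1 * (C * T ^+ 2))))).
  apply: (@le_trans _ _ (T * K2)); last by rewrite ler_wpM2l// le_max lexx orbT.
  (* As T <= 1, the higher powers of T produced by the error terms are reduced to the first
     power. *)
  have q4 : T^-1 * (c4 * T ^+ 4) <= T * c4.
    have -> : T^-1 * (c4 * T ^+ 4) = (T * c4) * T ^+ 2.
      by field; exact: lt0r_neq0.
    by rewrite ler_piMr ?mulr_ge0// exprn_ile1.
  have q8 : c8 * T ^+ 8 <= c8 by rewrite ler_piMr// exprn_ile1.
  have q2 : T^-1 * (C * T ^+ 2) = T * C by field; exact: lt0r_neq0.
  have q8' : T * (c8 * T ^+ 8) <= T * c8 by rewrite ler_wpM2l.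
  rewrite /K2 q2; lra.
apply: mean_le_dom big => // w; rewrite mm0/=.
apply: (@small_time_inequality _ _ _ _ (enorm (y T w) ^+ 2)) => //.
- exact: sqr_ge0.
- exact: sqr_enormB_le.
- exact: sqr_enorm_le_sub.
rewrite indicE; have [|] := boolP (w \in B); first by rewrite ltxx.
move=> wB _; rewrite /c -mulrA -exprMn; apply: sqr_enorm_le_normr.
by move/negP: wB; rewrite inE /B/= => /negP; rewrite -leNgt.
Qed.

End estimator.

Unset Implicit Arguments.
Set Strict Implicit.
Set Printing Implicit Defensive.

Theorem theorem3 (R : realType) (m : nat) (d : measure_display)
    (Omega : measurableType d) (P : probability Omega R)
    (F : R -> set (set Omega)) (W : R -> Omega -> 'rV[R]_m)
    (sigma : R) (f : R -> 'rV[R]_m -> 'rV[R]_m) (xi0 : 'rV[R]_m)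
    (phi : 'rV[R]_m -> R) (X : R -> R -> Omega -> 'rV[R]_m)
    (S : R) (Y y : R -> Omega -> 'rV[R]_m)
    (N : R -> Omega -> nat) (tg : R -> nat -> Omega -> R)
    (Yh yh : R -> R -> Omega -> 'rV[R]_m) :
  normal_filtration P F ->
  brownian_motion P F W ->
  0 < sigma ->
  regular_drift f ->
  (forall theta, unique_strong_solution P F W sigma (f theta) xi0 (X theta)) ->
  (forall theta, geometrically_ergodic P F W sigma (f theta) phi (X theta)) ->
  (forall x, differentiable phi x) ->
  poly_growth phi ->
  poly_growth (fun x => enorm (gradient phi x)) ->
  0 < S ->
  strong_solution P F W sigma (f 0) xi0 Y ->
  modified_variation P F f S Y y ->
  (forall T, 0 < T ->
    [/\ time_grid P F T (N T) (tg T),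
        numerical_approximation P F T (tg T) xi0 (Yh T) &
        numerical_approximation P F T (tg T) 0 (yh T)]) ->
  numerical_solution_assumption P (fun T => average_step P T (N T)) Yh Y ->
  numerical_solution_assumption P (fun T => average_step P T (N T)) yh y ->
  random_grid_moments P N tg yh ->
  exists eta : R, 0 < eta /\
    forall T, 0 < T ->
      ('V_P[pathwise_estimator S sigma W phi T (N T) (tg T) (Yh T) (yh T)]
        <= (eta / sigma ^+ 2 * T)%:E)%E.
Proof.
move=> nF bW sig0 rf _ _ dphi gphi ggrad S0 sY vy hT hYh hyh rg.
have gT T : 0 < T -> time_grid P F T (N T) (tg T) by case/hT.
have nYh T : 0 < T -> numerical_approximation P F T (tg T) xi0 (Yh T) by case/hT.
have nyh T : 0 < T -> numerical_approximation P F T (tg T) 0 (yh T) by case/hT.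
have [KB hB] := martingale_term_mean sigma S nF bW gT nYh nyh hYh hyh dphi gphi rg.
have [KA hA] := gradient_term_mean nF bW sig0 S0 gT nYh nyh hYh hyh dphi ggrad rf sY vy.
pose K := `|2 * (m%:R ^+ 2 * KA) + 2 * KB| + 1.
have K0 : 0 < K by rewrite ltr_wpDl.
have s20 : 0 < sigma ^+ 2 by rewrite exprn_gt0.
(* The constant may depend on sigma, so the factor sigma^2 cancels the quotient and the bound to
   prove is K T. *)
exists (sigma ^+ 2 * K); split; first exact: mulr_gt0.
move=> T T0; have [mB eB] := hB T T0; have eA := hA T T0.
pose A w := inner (gradient phi (Yh T T w)) (yh T T w).
have mcoord Z (i : 'I_m) : adapted_on F `[0, T] Z -> measurable_fun setT (fun w => Z T w 0 i).
  move=> aZ; apply: (measurableT_comp (@measurable_coord R m i)).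
  by apply: (adapted_measurable nF aZ) => //=; rewrite ?in_itv/= ltW/=.
have mA : measurable_fun setT A.
  apply: measurable_sum => i; apply: measurable_funM; last first.
    by apply: mcoord; case: (nyh T T0).
  rewrite (_ : (fun w => _) = (fun w => 'D_(delta_mx 0 i) phi (Yh T T w))); last first.
    by apply/funext => w; rewrite mxE.
  apply: (measurableT_comp (measurable_directional_derivative (delta_mx 0 i) dphi)).
  apply: (adapted_measurable nF (Z := Yh T) (I := `[0, T])) => //=.
  - by case: (nYh T T0).
  - exact: ltW.
  - by rewrite in_itv/= ltW/=.
apply: variance_le_mean_sqr; first exact: (measurable_funD mA mB).
apply: (@mean_leW _ _ _ _ _ (2 * (m%:R ^+ 2 * (T * KA)) + 2 * (T * KB))).
  have -> : sigma ^+ 2 * K / sigma ^+ 2 * T = T * K by field; exact: lt0r_neq0.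
  apply: (@le_trans _ _ (T * (2 * (m%:R ^+ 2 * KA) + 2 * KB))); first by lra.
  rewrite ler_wpM2l ?(ltW T0)// /K.
  have := ler_norm (2 * (m%:R ^+ 2 * KA) + 2 * KB); lra.
apply: (@mean_le_dom _ _ _ _ _ (fun w => 2 * (m%:R ^+ 2 *
  (enorm (gradient phi (Yh T T w)) ^+ 2 * enorm (yh T T w) ^+ 2)) +
  2 * martingale_term W sigma phi S N tg Yh yh T w ^+ 2)).
- exact: measurable_funX (measurable_funD mA mB).
- move=> w; rewrite sqr_ge0/=.
  rewrite -[pathwise_estimator _ _ _ _ _ _ _ _ _ _]/(A w +
    martingale_term W sigma phi S N tg Yh yh T w).
  have hAw : A w ^+ 2 <= m%:R ^+ 2 *
      (enorm (gradient phi (Yh T T w)) ^+ 2 * enorm (yh T T w) ^+ 2).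
    rewrite -[A w ^+ 2]real_normK ?num_real// -!exprMn.
    rewrite lerXn2r ?nnegrE ?mulr_ge0 ?enorm_ge0//; exact: normr_inner_le.
  have := sqr_ge0 (A w - martingale_term W sigma phi S N tg Yh yh T w).
  rewrite sqrrB sqrrD; lra.
- apply: mean_leD; apply: mean_leZ => //; apply: mean_leZ => //; exact: exprn_ge0.
Qed.
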